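(* Let $A$ be an almost TU matrix such that $A$ or $A^\top$ is the incidence matrix of a disjoint mixed hypergraph or of a laminar hypergraph. Then there exists a totally unimodular matrix $L$ such that $LA$ is an unbalanced hole.
   Context: A matrix is totally unimodular (TU) if every square submatrix has determinant in $\{0,\pm1\}$. A matrix is almost TU if it is not TU, but every proper submatrix of it is TU. A $\{0,\pm1\}$-matrix is a hole if it has exactly two nonzero entries in each row and each column, and no proper submatrix has this property. A hole is unbalanced if the sum of its entries is congruent to $2$ modulo $4$. A hypergraph $G=(V,E)$ consists of a finite vertex set $V$ and a finite multiset $E$ of non-empty subsets of $V$ (hyperedges); its incidence matrix in $\{0,1\}^{V\times E}$ has entry $1$ at $(v,e)$ if and only if $v\in e$. $G$ is laminar if its hyperedges of size at least $4$ form a laminar family (any two of them are disjoint or one is contained in the other). A mixed hypergraph is a pair $D=(V,A)$ where $V$ is a finite set and $A$ is a finite multiset of hyperarcs $a=(S(a),T(a))$ with $S(a),T(a)\subseteq V$ disjoint and not both empty. Its incidence matrix in $\{0,\pm1\}^{V\times A}$ has entry $1$ at $(v,a)$ if $v\in S(a)$, $-1$ if $v\in T(a)$, and $0$ otherwise. $D$ is disjoint if the sets $S(a)\cup T(a)$, over all hyperarcs $a$ with $|S(a)\cup T(a)|\ge4$, are pairwise disjoint. *)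

(* Defs.v *)
From HB Require Import structures.
From mathcomp Require Import all_boot all_order all_algebra.

Set Implicit Arguments.
Unset Strict Implicit.
Unset Printing Implicit Defensive.

Import Order.TTheory GRing.Theory Num.Theory.

Local Open Scope ring_scope.

(* A submatrix is [mxsub f g A] for strictly increasing row and column
   selections [f] and [g]; it is proper when a row or a column is missing. *)
Definition increasing (k m : nat) (f : 'I_k -> 'I_m) : Prop :=
  forall i j : 'I_k, (i < j)%N -> (f i < f j)%N.

Definition totally_unimodular (m n : nat) (A : 'M[int]_(m, n)) : Prop :=
  forall (k : nat) (f : 'I_k -> 'I_m) (g : 'I_k -> 'I_n),
    increasing f -> increasing g -> \det (mxsub f g A) \in [:: 0; 1; -1].

Definition almost_totally_unimodular (m n : nat) (A : 'M[int]_(m, n)) : Prop :=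
  ~ totally_unimodular A /\
  forall (k l : nat) (f : 'I_k -> 'I_m) (g : 'I_l -> 'I_n),
    increasing f -> increasing g -> (k < m)%N \/ (l < n)%N ->
    totally_unimodular (mxsub f g A).

Definition two_nonzeros_per_line (m n : nat) (A : 'M[int]_(m, n)) : Prop :=
  (forall i : 'I_m, #|[set j : 'I_n | A i j != 0]| = 2) /\
  (forall j : 'I_n, #|[set i : 'I_m | A i j != 0]| = 2).

(* The empty matrix satisfies [two_nonzeros_per_line] vacuously, so only
   submatrices with at least one row and one column are excluded. *)
Definition hole (m n : nat) (A : 'M[int]_(m, n)) : Prop :=
  [/\ forall i j, A i j \in [:: 0; 1; -1],
      two_nonzeros_per_line A
    & forall (k l : nat) (f : 'I_k -> 'I_m) (g : 'I_l -> 'I_n),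
        increasing f -> increasing g ->
        (0 < k)%N -> (0 < l)%N -> (k < m)%N \/ (l < n)%N ->
        ~ two_nonzeros_per_line (mxsub f g A)].

Definition unbalanced_hole (m n : nat) (A : 'M[int]_(m, n)) : Prop :=
  hole A /\ (\sum_(i < m) \sum_(j < n) A i j = 2 %[mod 4])%Z.

(* Vertex set 'I_m; the multiset of hyperedges is a family indexed by 'I_n, so
   that parallel hyperedges are distinct indices. *)
Record hypergraph (m n : nat) := Hypergraph {
  hyperedge : 'I_n -> {set 'I_m};
  hyperedge_neq0 : forall e, hyperedge e != set0
}.

Definition hypergraph_incidence (m n : nat) (G : hypergraph m n) :
    'M[int]_(m, n) :=
  \matrix_(v, e) (if v \in hyperedge G e then 1 else 0).

Definition laminar (m n : nat) (G : hypergraph m n) : Prop :=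
  forall e f : 'I_n,
    (4 <= #|hyperedge G e|)%N -> (4 <= #|hyperedge G f|)%N ->
    [\/ [disjoint hyperedge G e & hyperedge G f],
        hyperedge G e \subset hyperedge G f
      | hyperedge G f \subset hyperedge G e].

Record mixed_hypergraph (m n : nat) := MixedHypergraph {
  arc_source : 'I_n -> {set 'I_m};
  arc_target : 'I_n -> {set 'I_m};
  arc_disjoint : forall a, [disjoint arc_source a & arc_target a];
  arc_neq0 : forall a, arc_source a :|: arc_target a != set0
}.

Definition arc_support (m n : nat) (D : mixed_hypergraph m n) (a : 'I_n) :
    {set 'I_m} :=
  arc_source D a :|: arc_target D a.

Definition mixed_incidence (m n : nat) (D : mixed_hypergraph m n) :
    'M[int]_(m, n) :=
  \matrix_(v, a) (if v \in arc_source D a then 1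
                  else if v \in arc_target D a then -1 else 0).

(* Distinctness is that of indices: two parallel hyperarcs with at least 4
   vertices violate the condition. *)
Definition disjoint_mixed (m n : nat) (D : mixed_hypergraph m n) : Prop :=
  forall a b : 'I_n, a != b ->
    (4 <= #|arc_support D a|)%N -> (4 <= #|arc_support D b|)%N ->
    [disjoint arc_support D a & arc_support D b].

Definition disjoint_mixed_or_laminar_incidence (m n : nat)
    (A : 'M[int]_(m, n)) : Prop :=
  (exists D : mixed_hypergraph m n,
      disjoint_mixed D /\ A = mixed_incidence D) \/
  (exists G : hypergraph m n, laminar G /\ A = hypergraph_incidence G).

(* Main.v *)
Require Import Defs.
From mathcomp Require Import all_boot all_order all_algebra.
From mathcomp Require Import zify ring.

Set Implicit Arguments.
Unset Strict Implicit.
Unset Printing Implicit Defensive.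

Import Order.TTheory GRing.Theory Num.Theory.

Local Open Scope ring_scope.

(** If [A] is almost TU of order [n >= 2], then [S = 2 A^-1] is a matrix of
    signs, and [S] has no Hadamard submatrix of order 4, since the complementary
    minor of [A] would be [2] or [-2].

    Let the rows of [B] (either [A] or its transpose) be the hyperedges. All of
    them have even size; those of size 2 form a graph on the columns, the others
    are "big". Counting degrees in that graph against the cells cut out by the
    big rows, and using the absence of Hadamard submatrices to bound the number
    of leaves in a cell, leaves three possibilities: there is no big row; there
    is one big row, consisting of three leaves and one further column; or (in
    the laminar case only) there are two big rows [s] and [r = s + x + x'] where
    [x], [x'] are leaves and [s] contains an isolated column.

    In each case [L = I - u v] with [u], [v] of disjoint supports, which is TU
    with inverse [I + u v], turns both [B] and its transpose into a matrix with
    two nonzero entries in every row and column. Since [S] is congruent to the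
    all-ones matrix modulo 2, such a product is always an unbalanced hole. *)

(** * Minors and rank-one updates *)

Definition sgn01 : seq int := [:: 0; 1; -1].

Lemma sgn01P (x : int) : reflect [\/ x = 0, x = 1 | x = -1] (x \in sgn01).
Proof.
rewrite !inE; apply: (iffP or3P) => -[] => [/eqP|/eqP|/eqP||| ] ->; rewrite ?eqxx;
  by [constructor 1 | constructor 2 | constructor 3].
Qed.

Lemma sgn01M (x y : int) : x \in sgn01 -> y \in sgn01 -> x * y \in sgn01.
Proof. by move=> /sgn01P[]-> /sgn01P[]->. Qed.

Lemma sgn01N (x : int) : x \in sgn01 -> - x \in sgn01.
Proof. by move=> /sgn01P[]->. Qed.

Lemma sgn01_signM (k : nat) (x : int) : x \in sgn01 -> (-1) ^+ k * x \in sgn01.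
Proof. by move=> hx; apply: sgn01M => //; rewrite -signr_odd; case: odd. Qed.

Lemma increasing_inj k m (f : 'I_k -> 'I_m) : increasing f -> injective f.
Proof.
move=> incf i j eq_f; apply/val_inj => /=.
by case: (ltngtP i j) => // /incf; rewrite eq_f ltnn.
Qed.

Lemma increasing_leq k m (f : 'I_k -> 'I_m) : increasing f -> (k <= m)%N.
Proof. by move/increasing_inj/leq_card; rewrite !card_ord. Qed.

Lemma increasing_lift n (i : 'I_n) : increasing (lift i).
Proof. by move=> a b /=; rewrite /bump; lia. Qed.

Lemma increasing_comp k l m (f : 'I_l -> 'I_m) (g : 'I_k -> 'I_l) :
  increasing f -> increasing g -> increasing (f \o g).
Proof. by move=> incf incg i j /incg /incf. Qed.

(** A strict inequality [i < f i] would propagate to all later indices and push the image of the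
    last one out of range. *)
Lemma increasing_id n (f : 'I_n -> 'I_n) : increasing f -> f =1 id.
Proof.
move=> incf.
have ge_f : forall i : 'I_n, (i <= f i)%N.
  move=> [i]; elim: i => // i IHi lt_in.
  exact: leq_ltn_trans (IHi (ltnW lt_in)) (incf (Ordinal (ltnW lt_in)) _ _).
move=> i; apply/val_inj/eqP => /=; rewrite eqn_leq ge_f andbT leqNgt.
apply/negP => lt_if.
have incr : forall d (j : 'I_n), (j = i + d :> nat)%N -> (j < f j)%N.
  elim=> [|d IHd] j def_j; first by have -> : j = i by apply/val_inj; rewrite /= def_j addn0.
  have lt_d : (i + d < n)%N by rewrite (leq_trans _ (ltn_ord j)) // def_j addnS.
  have := IHd (Ordinal lt_d) erefl => /= lt_f.
  have : (f (Ordinal lt_d) < f j)%N by apply: incf; rewrite /= def_j addnS.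
  by rewrite def_j addnS; apply: leq_ltn_trans.
have lt_n1 : (n.-1 < n)%N by have := ltn_ord i; lia.
have := incr (n.-1 - i)%N (Ordinal lt_n1); have := ltn_ord (f (Ordinal lt_n1)).
by move=> /= lt_fn /(_ _); have := ltn_ord i; lia.
Qed.

Lemma totally_unimodular_tr m n (A : 'M[int]_(m, n)) :
  totally_unimodular A -> totally_unimodular A^T.
Proof. by move=> tuA k f g incf incg; rewrite -det_tr trmx_mxsub trmxK; apply: tuA. Qed.

Lemma almost_totally_unimodular_tr m n (A : 'M[int]_(m, n)) :
  almost_totally_unimodular A -> almost_totally_unimodular A^T.
Proof.
move=> [ntuA subA]; split=> [/totally_unimodular_tr|k l f g incf incg lt_kl].
  by rewrite trmxK.
rewrite -trmx_mxsub; apply: totally_unimodular_tr; apply: subA => //.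
by case: lt_kl; [right | left].
Qed.

(** If [m] and [n] differed, every square submatrix would miss a row or a column, so all its minors
    would be good and [A] would be TU. *)
Lemma almost_totally_unimodular_square m n (A : 'M[int]_(m, n)) :
  almost_totally_unimodular A -> m = n.
Proof.
move=> [ntuA subA]; apply/eqP/negP => neq_mn; apply: ntuA => k f g incf incg.
have [lekm lekn] := (increasing_leq incf, increasing_leq incg).
have := subA k k f g incf incg _ k id id.
rewrite -mxsub_comp; apply=> //.
case: (ltnP k m) => [|lemk]; [by left | right].
rewrite ltn_neqAle lekn andbT; apply: contraPN neq_mn => /eqP eq_kn.
by rewrite -{1}eq_kn eqn_leq lekm lemk.
Qed.

Lemma almost_totally_unimodular_minor n (A : 'M[int]_n) k
    (f g : 'I_k -> 'I_n) :
  almost_totally_unimodular A -> increasing f -> increasing g -> (k < n)%N ->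
  \det (mxsub f g A) \in sgn01.
Proof.
move=> [_ subA] incf incg lt_kn.
by have := subA k k f g incf incg (or_introl lt_kn) k id id; rewrite -mxsub_comp; apply.
Qed.

Lemma almost_totally_unimodular_det n (A : 'M[int]_n) :
  almost_totally_unimodular A -> \det A \notin sgn01.
Proof.
move=> atuA; apply/negP => detA; apply: (atuA.1) => k f g incf incg.
have [lt_kn|le_nk] := ltnP k n; first exact: almost_totally_unimodular_minor.
have eq_kn : k = n by apply/eqP; rewrite eqn_leq le_nk (increasing_leq incf).
subst k; rewrite (_ : mxsub f g A = A) //; apply/matrixP => i j.
by rewrite mxE !increasing_id.
Qed.

(* Rows outside the support of [u] and columns outside the support of [v] are
   unit vectors; what remains of a minor after deleting them has rank at most
   one. *)
Lemma det_sub_rank1 n (u : 'cV[int]_n) (v : 'rV[int]_n) k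
    (f g : 'I_k -> 'I_n) :
  (forall i, u i 0 \in sgn01) -> (forall i, v 0 i \in sgn01) ->
  (forall i, u i 0 * v 0 i = 0) -> injective f -> injective g ->
  \det (mxsub f g (1%:M - u *m v)) \in sgn01.
Proof.
move=> u01 v01 uv0; elim: k f g => [|k IHk] f g injf injg; first by rewrite det_mx00.
have entry i j : (1%:M - u *m v) i j = (i == j)%:R - u i 0 * v 0 j.
  by rewrite !mxE big_ord1.
have minor i j : cofactor (mxsub f g (1%:M - u *m v)) i j \in sgn01.
  apply: sgn01_signM.
  have -> : row' i (col' j (mxsub f g (1%:M - u *m v))) =
            mxsub (f \o lift i) (g \o lift j) (1%:M - u *m v).
    by apply/matrixP => a b; rewrite !mxE.
  by apply: IHk; apply: inj_comp => //; apply: lift_inj.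
have [i /eqP ui0 | u_neq0] := pickP (fun i => u (f i) 0 == 0).
  rewrite (expand_det_row _ i).
  have rowE j : mxsub f g (1%:M - u *m v) i j = (f i == g j)%:R.
    by rewrite mxE entry ui0 mul0r subr0.
  have [j /eqP fgij | nofg] := pickP (fun j => f i == g j).
    rewrite (bigD1 j) //= big1 => [|j' j'j]; first by rewrite addr0 rowE fgij eqxx mul1r.
    by rewrite rowE fgij (inj_eq injg) eq_sym (negPf j'j) mul0r.
  by rewrite big1 // => j _; rewrite rowE nofg mul0r.
have [j /eqP vj0 | v_neq0] := pickP (fun j => v 0 (g j) == 0).
  rewrite (expand_det_col _ j).
  have colE i : mxsub f g (1%:M - u *m v) i j = (f i == g j)%:R.
    by rewrite mxE entry vj0 mulr0 subr0.
  have [i /eqP fgij | nofg] := pickP (fun i => f i == g j).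
    rewrite (bigD1 i) //= big1 => [|i' i'i]; first by rewrite addr0 colE fgij eqxx mul1r.
    by rewrite colE -fgij (inj_eq injf) (negPf i'i) mul0r.
  by rewrite big1 // => i _; rewrite colE nofg mul0r.
(* All selected rows now meet the support of [u] and all selected columns that of [v], so the
   identity contributes nothing. *)
have rank1 i j : mxsub f g (1%:M - u *m v) i j = - (u (f i) 0 * v 0 (g j)).
  rewrite mxE entry; case: eqP => [fgij|_]; last by rewrite sub0r.
  have /eqP := uv0 (f i); rewrite mulf_eq0 u_neq0 fgij v_neq0.
  by [].
case: k f g injf injg {IHk minor} u_neq0 v_neq0 rank1 => [|k] f g _ _ u_neq0 v_neq0 rank1.
  by rewrite det_mx11 rank1; apply/sgn01N/sgn01M.
suff /det0P/eqP-> : exists2 w : 'rV_k.+2, w != 0 & w *m mxsub f g (1%:M - u *m v) = 0.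
  by rewrite !inE.
pose i1 : 'I_k.+2 := lift ord0 ord0.
exists (u (f i1) 0 *: delta_mx 0 0 - u (f 0) 0 *: delta_mx 0 i1).
  apply/eqP => /rowP/(_ 0); rewrite !mxE /= mulr1 mulr0 subr0 => /eqP.
  by rewrite u_neq0.
apply/rowP => j; rewrite mulmxBl -!scalemxAl -!rowE !mxE.
have := rank1 0 j; have := rank1 i1 j; rewrite !mxE => -> ->.
by rewrite !mulrN opprK mulrCA addNr.
Qed.

Lemma totally_unimodular_rank1 n (u : 'cV[int]_n) (v : 'rV[int]_n) :
  (forall i, u i 0 \in sgn01) -> (forall i, v 0 i \in sgn01) ->
  (forall i, u i 0 * v 0 i = 0) -> totally_unimodular (1%:M - u *m v).
Proof.
move=> u01 v01 uv0 k f g /increasing_inj injf /increasing_inj injg.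
exact: det_sub_rank1.
Qed.

(** * The sign matrix [2 A^-1] *)

(** Unit vectors as columns encode complementary minors: one replaced column gives an entry of the
    adjugate. *)
Definition replace_cols n (A : 'M[int]_n) (C : pred 'I_n) (q : 'I_n -> 'I_n) :=
  \matrix_(i, j) (if C j then (i == q j)%:R else A i j).

(** Expansion along a unit column leaves at most one cofactor, so the induction ends in a proper
    submatrix of [A]; at full order one replaced column is enough for this. *)
Lemma det_replace_cols n (A : 'M[int]_n) (C : pred 'I_n) q k (f g : 'I_k -> 'I_n) :
  almost_totally_unimodular A -> increasing f -> increasing g ->
  (k < n)%N \/ (exists j, C (g j)) ->
  \det (mxsub f g (replace_cols A C q)) \in sgn01.
Proof.
move=> atuA; elim: k f g => [|k IHk] f g incf incg; first by rewrite det_mx00.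
have [j Cj _ | noC [lt_kn|[j]]] := pickP (fun j => C (g j)); last 2 first.
- rewrite (_ : mxsub _ _ _ = mxsub f g A); first exact: almost_totally_unimodular_minor.
  by apply/matrixP => i j; rewrite !mxE noC.
- by rewrite noC.
have le_kn := increasing_leq incf.
have minor i : cofactor (mxsub f g (replace_cols A C q)) i j \in sgn01.
  apply: sgn01_signM.
  have -> : row' i (col' j (mxsub f g (replace_cols A C q))) =
            mxsub (f \o lift i) (g \o lift j) (replace_cols A C q).
    by apply/matrixP => a b; rewrite !mxE.
  apply: IHk; [| | by left].
    exact: increasing_comp incf (@increasing_lift _ i).
  exact: increasing_comp incg (@increasing_lift _ j).
rewrite (expand_det_col _ j).
have colE i : mxsub f g (replace_cols A C q) i j = (f i == q (g j))%:R.
  by rewrite !mxE Cj.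
have [i /eqP fi | nofi] := pickP (fun i => f i == q (g j)).
  rewrite (bigD1 i) //= big1 => [|i' i'i]; first by rewrite addr0 colE fi eqxx mul1r.
  by rewrite colE -fi (inj_eq (increasing_inj incf)) (negPf i'i) mul0r.
by rewrite big1 // => i _; rewrite colE nofi mul0r.
Qed.

Lemma det_replace_cols_full n (A : 'M[int]_n) (C : pred 'I_n) q j :
  almost_totally_unimodular A -> C j -> \det (replace_cols A C q) \in sgn01.
Proof.
move=> atuA Cj; have -> : replace_cols A C q = mxsub id id (replace_cols A C q).
  by apply/matrixP => a b; rewrite !mxE.
by apply: det_replace_cols => //; right; exists j.
Qed.

Lemma det_replace_col n (A : 'M[int]_n) (l m : 'I_n) :
  \det (replace_cols A (pred1 l) (fun=> m)) = \adj A l m.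
Proof.
rewrite (expand_det_col _ l) (bigD1 m) //= big1 => [|i im].
  rewrite addr0 !mxE /= !eqxx mul1r /cofactor; congr (_ * \det _).
  by apply/matrixP => a b; rewrite !mxE /= eq_sym (negPf (neq_lift _ _)).
by rewrite !mxE /= eqxx (negPf im) mul0r.
Qed.

(* Cramer's rule with one column replaced: a vector [x] vanishing at [l] does
   not see the replaced column. *)
Lemma adj_replace_col n (A : 'M[int]_n) (l m : 'I_n) (x : 'cV[int]_n) (d c : int) i :
  x l 0 = 0 -> A *m x = d *: (delta_mx i 0 + c *: delta_mx m 0) ->
  forall j, exists t, \adj A l m * x j 0 = d * t.
Proof.
move=> xl0 Ax j; set A' := replace_cols A (pred1 l) (fun=> m).
have [->|jl] := eqVneq j l; first by exists 0; rewrite xl0 !mulr0.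
(* Column [l] of [A'] is the unit vector at [m], so this correction removes the term at [m]. *)
have A'x : A' *m (x - (d * c) *: delta_mx l 0) = d *: delta_mx i 0.
  have A'xE : A' *m x = A *m x.
    apply/colP => a; rewrite !mxE; apply: eq_bigr => b _; rewrite mxE /=.
    by case: eqP => // ->; rewrite xl0 !mulr0.
  have : A' *m delta_mx l 0 = delta_mx m 0 :> 'cV_n.
    by apply/colP => a; rewrite -colE !mxE /= !eqxx andbT.
  by rewrite mulmxBr -scalemxAr A'xE => ->; rewrite Ax scalerDr scalerA addrK.
exists ((\adj A' *m delta_mx i 0) j (0 : 'I_1)).
have := congr1 (fun v => (\adj A' *m v) j 0) A'x.
rewrite mulmxA mul_adj_mx det_replace_col mul_scalar_mx -scalemxAr.
by rewrite !mxE (negPf jl) /= mulr0 oppr0 addr0.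
Qed.

Lemma sgn01_dvd (x d t : int) : x \in sgn01 -> d \notin sgn01 -> x = d * t -> x = 0.
Proof.
move=> /sgn01P x01 d01 def_x; rewrite def_x; case: (eqVneq t 0) => [->|t0]; first by rewrite mulr0.
have d_ge2 : d <= -2 \/ d >= 2.
  by have := d01; rewrite !inE; lia.
have t_ge1 : t <= -1 \/ t >= 1 by lia.
by case: x01 => x01; case: d_ge2 t_ge1 => ? [] ?; nia.
Qed.

(** If [W l i = 0], column [i] of the adjugate [W] vanishes at [l], so [d] divides every product
    [W l m * W j i], which is then 0. Hence row [l] or column [i] of [W] is zero, although [W] is
    invertible over the rationals. *)
Lemma adj_entry_neq0 n (A : 'M[int]_n) :
  almost_totally_unimodular A -> forall l m, \adj A l m != 0.
Proof.
move=> atuA.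
have d01 := almost_totally_unimodular_det atuA; set d := \det A in d01.
have d_neq0 : d != 0 by apply: contraNneq d01 => ->.
have W01 l m : \adj A l m \in sgn01.
  by rewrite -det_replace_col; apply: (@det_replace_cols_full _ _ _ _ l) => //=.
have := @adj_replace_col _ A; have := mul_adj_mx A; have := mul_mx_adj A.
move: (\adj A) W01 => W W01 AW WA solve l i; apply/eqP => Wli.
have col_i j : (A *m col i W) j 0 = d * (j == i)%:R.
  by rewrite colE mulmxA AW mul_scalar_mx !mxE andbT.
have row_l m : W l m = 0.
  apply/eqP; apply: contraT => Wlm.
  have Wi0 j : W j i = 0.
    have [||t] := solve l m (col i W) d 0 i _ _ j.
    - by rewrite mxE.
    - by apply/colP => a; rewrite col_i !mxE andbT mul0r addr0.
    rewrite mxE => def_t; have := W01 l m; have := W01 j i.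
    move=> /sgn01_dvd/(_ d01 _)Wji0 /sgn01P[] Wlm'; rewrite Wlm' ?eqxx // in Wlm def_t.
      by apply: (Wji0 t); rewrite -def_t mul1r.
    by apply: (Wji0 (- t)); rewrite mulrN -def_t mulN1r opprK.
  have := col_i i; rewrite mxE big1 => [/eqP|j _]; last by rewrite mxE Wi0 mulr0.
  by rewrite eqxx mulr1 eq_sym (negPf d_neq0).
have /matrixP/(_ l l) := WA; rewrite !mxE eqxx big1 => [/eqP|j _].
  by rewrite eq_sym (negPf d_neq0).
by rewrite row_l mul0r.
Qed.

Definition sign_matrix n (S : 'M[int]_n) := forall i j, S i j = 1 \/ S i j = -1.

(** For a sign matrix, orthogonality makes the four chosen rows distinct and, the block being
    nonsingular, the four columns too. *)
Definition hadamard_free n (S : 'M[int]_n) :=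
  forall p q : 'I_4 -> 'I_n,
    ~ (forall a b, a != b -> \sum_c S (p a) (q c) * S (p b) (q c) = 0).

Lemma sign_mul_self (x : int) : x = 1 \/ x = -1 -> x * x = 1.
Proof. by case=> ->. Qed.

(* Columns [i] and [m] of the adjugate are sign vectors, so some combination
   [x] of them vanishes in one place and is [+-2] in another; the determinant
   divides its entries. *)
Lemma exists_half_inverse n (A : 'M[int]_n) :
  (1 < n)%N -> almost_totally_unimodular A ->
  exists S, [/\ A *m S = 2%:M, S *m A = 2%:M & sign_matrix S].
Proof.
move=> n_gt1 atuA.
have d01 := almost_totally_unimodular_det atuA; set d := \det A in d01.
have d_neq0 : d != 0 by apply: contraNneq d01 => ->.
have W1 l m : \adj A l m = 1 \/ \adj A l m = -1.
  have := adj_entry_neq0 atuA l m; rewrite -det_replace_col.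
  have /sgn01P[->|->|->] := @det_replace_cols_full _ A (pred1 l) (fun=> m) l atuA (eqxx l).
  - by rewrite eqxx.
  - by left.
  - by right.
have := @adj_replace_col _ A; have := mul_adj_mx A; have := mul_mx_adj A.
move: (\adj A) W1; rewrite -/d => W W1 AW WA solve.
suff [d2|d2] : d = 2 \/ d = -2.
- by exists W; split; rewrite // ?AW ?WA d2.
- exists (- W); split; [by rewrite mulmxN AW d2 -raddfN /= opprK | by rewrite mulNmx WA d2 -raddfN /= opprK |].
  by move=> i j; rewrite mxE; case: (W1 i j) => ->; [right | left].
pose i : 'I_n := Ordinal (ltnW n_gt1); pose m : 'I_n := Ordinal n_gt1.
(* This sign makes [x] vanish at [i]. *)
pose c := - (W i i * W i m).
pose x := col i W + c *: col m W.
have c1 : c = 1 \/ c = -1.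
  by rewrite /c; case: (W1 i i) (W1 i m) => -> [] ->; [right|left|left|right].
have xE j : x j 0 = W j i + c * W j m by rewrite !mxE.
have xi0 : x i 0 = 0.
  by rewrite xE /c mulNr -mulrA sign_mul_self // mulr1 subrr.
have Ax : A *m x = d *: (delta_mx i 0 + c *: delta_mx m 0).
  rewrite mulmxDr -scalemxAr !colE !mulmxA !AW !mul_scalar_mx scalerDr.
  by rewrite !scalerA mulrC.
have [j xj] : exists j, x j 0 != 0.
  apply/existsP; apply: contraT; rewrite negb_exists => /forallP x0.
  have x_eq0 : x = 0 by apply/colP => j; rewrite [RHS]mxE; apply/eqP; have := x0 j; rewrite negbK.
  have /colP/(_ i) := Ax; rewrite x_eq0 mulmx0 !mxE eqxx /= mulr0 addr0 mulr1.
  by move/esym/eqP; rewrite (negPf d_neq0).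
have [t def_t] := solve i m x d c i xi0 Ax j.
have t_neq0 : t != 0.
  apply: contra_neq xj => t0; move: def_t; rewrite t0 mulr0 => /eqP.
  by rewrite mulf_eq0 => /orP[|/eqP //]; case: (W1 i m) => ->.
have t_big : t <= -1 \/ t >= 1 by lia.
have d_big : d <= -2 \/ d >= 2 by have := d01; rewrite !inE; lia.
move: def_t; rewrite xE.
by case: (W1 i m) (W1 j i) (W1 j m) c1 => -> [] -> [] -> [] -> def_t;
  case: d_big t_big => ? [] ?; nia.
Qed.

Lemma sign_sum4_even (f : 'I_4 -> int) :
  (forall a, f a = 1 \/ f a = -1) -> (2 %| \sum_a f a)%Z.
Proof.
move=> f1; rewrite !big_ord_recl big_ord0.
by do 4![match goal with |- context [f ?a] => case: (f1 a) => -> end].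
Qed.

(* For a Hadamard submatrix [K] of [S] on rows [p] and columns [q], replace the
   columns [p] of [A] by the unit vectors [q]. An odd vector is mapped to an even
   one, so the new determinant is even, hence 0; but [K] invertible makes it
   nonzero. *)
Lemma half_inverse_hadamard_free n (A S : 'M[int]_n) :
  almost_totally_unimodular A -> A *m S = 2%:M -> S *m A = 2%:M ->
  sign_matrix S -> hadamard_free S.
Proof.
move=> atuA AS SA S1 p q orth.
have S2 i j : S i j * S i j = 1 by apply: sign_mul_self.
have orthE a b : \sum_c S (p a) (q c) * S (p b) (q c) = 4 * (a == b)%:R.
  have [->|ab] := eqVneq a b; last by rewrite orth // mulr0.
  by rewrite (eq_bigr (fun=> 1)) => [|c _]; rewrite ?sumr_const ?card_ord ?S2.
have injp : injective p.
  move=> a b pab; apply/eqP; apply: contraT => ab.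
  have := orthE a b; have := orthE b b; rewrite pab eqxx (negPf ab).
  by move=> ->.
pose C : pred 'I_n := fun j => j \in p @: [set: 'I_4].
have Cp a : C (p a) by apply/imset_f.
have sumC (F : 'I_n -> int) : \sum_(j | C j) F j = \sum_a F (p a).
  rewrite big_imset /=; last by move=> a b _ _; apply: injp.
  by apply: eq_bigl => a; rewrite inE.
pose r j := if [pick a | p a == j] is Some a then q a else j.
have rp a : r (p a) = q a.
  rewrite /r; case: pickP => [b /eqP/injp -> //|/(_ a)]; by rewrite eqxx.
pose A' := replace_cols A C r.
have detA' : \det A' \in sgn01 by apply: (@det_replace_cols_full _ _ _ _ (p 0)).
(* Row [p 0] of the block, placed on the coordinates [q]: by orthogonality [S w] is 4 at [p 0] and 0
   at the other [p a]. All entries of [S w] are sums of four signs, so its half [z] is integral and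
   solves [A z = w]. *)
pose w := \col_j \sum_a (j == q a)%:R * S (p 0) (q a).
pose z := \col_j ((S *m w) j ord0 %/ 2)%Z.
have sum_pick (F : 'I_n -> int) a : \sum_j F j * (j == q a)%:R = F (q a).
  rewrite (bigD1 (q a)) //= big1 => [|j /negPf->]; last by rewrite mulr0.
  by rewrite eqxx mulr1 addr0.
have SwE j : (S *m w) j 0 = \sum_a S j (q a) * S (p 0) (q a).
  rewrite mxE (eq_bigr (fun k => \sum_a S j k * (k == q a)%:R * S (p 0) (q a))).
    rewrite exchange_big; apply: eq_bigr => a _; rewrite -mulr_suml.
    by rewrite sum_pick.
  by move=> k _; rewrite mxE mulr_sumr; apply: eq_bigr => a _; rewrite mulrA.
have zE : S *m w = 2 *: z.
  apply/colP => j; rewrite [RHS]mxE [z j _]mxE SwE mulrC divzK //.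
  by apply: sign_sum4_even => a; case: (S1 j (q a)) (S1 (p 0) (q a)) => -> [] ->; [left|right|right|left].
have Az : A *m z = w.
  apply/colP => i; apply: (@mulfI _ 2) => //.
  have /colP/(_ i) : A *m (2 *: z) = 2 *: w by rewrite -zE mulmxA AS mul_scalar_mx.
  by rewrite -scalemxAr !mxE.
have zp a : z (p a) 0 = 2 * (a == 0)%:R.
  apply: (@mulfI _ 2) => //; have /colP/(_ (p a)) := zE; rewrite SwE orthE [RHS]mxE => <-.
  by rewrite mulrA.
(* The entries on [p] are odd and chosen to cancel [w], so that [A' y] is just [-2] times a column
   of [A]. *)
pose y := \col_j (if [pick a | p a == j] is Some a then - S (p 0) (q a) else z j 0).
have yp a : y (p a) 0 = - S (p 0) (q a).
  rewrite mxE; case: pickP => [b /eqP/injp -> //|/(_ a)]; by rewrite eqxx.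
have yC j : ~~ C j -> y j 0 = z j 0.
  by rewrite mxE; case: pickP => // a /eqP<-; rewrite Cp.
have A'y : A' *m y = - (2 *: col (p 0) A).
  apply/colP => i; rewrite [LHS]mxE (bigID C) /= sumC.
  have -> : \sum_(j | ~~ C j) A' i j * y j 0 = \sum_(j | ~~ C j) A i j * z j 0.
    by apply: eq_bigr => j Cj; rewrite yC // mxE (negPf Cj).
  have -> : \sum_a A' i (p a) * y (p a) 0 = - w i 0.
    rewrite [w i 0]mxE -sumrN; apply: eq_bigr => a _.
    by rewrite mxE Cp rp yp mulrN.
  have sumAz : \sum_a A i (p a) * z (p a) 0 = 2 * A i (p 0).
    rewrite (bigD1 0) //= zp big1 => [|a /negPf a0]; last by rewrite zp a0 !mulr0.
    by rewrite eqxx mulr1 addr0 mulrC.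
  have /colP/(_ i) := Az; rewrite [LHS]mxE (bigID C) /= sumC sumAz => <-.
  by rewrite opprD addrNK !mxE.
have detA'0 : \det A' = 0.
  have : \det A' * y (p 0) 0 = - 2 * (\adj A' *m col (p 0) A) (p 0) 0.
    have /colP/(_ (p 0)) := congr1 (mulmx (\adj A')) A'y.
    rewrite mulmxA mul_adj_mx mul_scalar_mx mulmxN -scalemxAr mxE => ->.
    by rewrite [LHS]mxE [X in - X]mxE mulNr.
  rewrite yp; move: (_ (p 0) 0) => t; case: (S1 (p 0) (q 0)) => ->;
  by case/sgn01P: detA' => ->; lia.
(* A left kernel vector [v] of [A'] vanishes on [q], and [s = v A] vanishes outside [p]. Since
   [2 v = s S], the restriction of [s] to [p] is killed by the block, whose rows are orthogonal;
   hence [s = 0] and [v = 0]. *)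
have /det0P[v v_neq0 vA'] : \det A' == 0 by rewrite detA'0.
case/eqP: v_neq0.
pose s := v *m A.
have vE : 2 *: v = s *m S by rewrite -mulmxA AS mul_mx_scalar.
have s0 j : ~~ C j -> s 0 j = 0.
  move=> Cj; have /rowP/(_ j) := vA'; rewrite [RHS]mxE => <-.
  by rewrite !mxE; apply: eq_bigr => i _; rewrite mxE (negPf Cj).
have vq a : v 0 (q a) = 0.
  have /rowP/(_ (p a)) := vA'; rewrite [RHS]mxE => <-; rewrite mxE -[LHS](sum_pick (v 0)).
  by apply: eq_bigr => i _; rewrite mxE Cp rp.
have sK b : \sum_a s 0 (p a) * S (p a) (q b) = 0.
  have /rowP/(_ (q b)) := vE; rewrite [LHS]mxE vq mulr0 => sSq.
  rewrite [RHS]sSq mxE (bigID C) /= sumC [X in _ = _ + X]big1 ?addr0 //.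
  by move=> j /s0->; rewrite mul0r.
have sp a : s 0 (p a) = 0.
  have : \sum_b (\sum_a' s 0 (p a') * S (p a') (q b)) * S (p a) (q b) = 0.
    by rewrite big1 // => b _; rewrite sK mul0r.
  under eq_bigr => b _ do rewrite mulr_suml.
  rewrite exchange_big /= (bigD1 a) //= [X in _ + X]big1 => [|a' a'a].
    rewrite addr0 (eq_bigr (fun b => s 0 (p a) * (S (p a) (q b) * S (p a) (q b)))).
      by rewrite -mulr_sumr orthE eqxx => /eqP; rewrite mulf_eq0 orbF => /eqP.
    by move=> b _; rewrite mulrA.
  rewrite (eq_bigr (fun b => s 0 (p a') * (S (p a') (q b) * S (p a) (q b)))).
    by rewrite -mulr_sumr orthE (negPf a'a) !mulr0.
  by move=> b _; rewrite mulrA.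
have s_eq0 : s = 0.
  apply/rowP => j; rewrite [RHS]mxE; case Cj : (C j); last by rewrite s0 ?Cj.
  by case/imsetP: Cj => a _ ->.
apply/rowP => j; have /rowP/(_ j) := vE; rewrite s_eq0 mul0mx !mxE => /eqP.
by rewrite mulf_eq0 => /orP[//|/eqP].
Qed.

(** * Unbalanced holes *)

Lemma sum_sgn01_parity (T : finType) (P : pred T) (x : T -> int) :
  (forall i, P i -> x i \in sgn01) ->
  (2 %| \sum_(i | P i) x i - #|[set i | P i & x i != 0%R]|%:Z)%Z.
Proof.
move=> x01; rewrite -sum1_card (eq_bigl (fun i => P i && (x i != 0))) => [|i]; last by rewrite inE.
rewrite big_mkcondr /= (big_morph _ PoszD erefl) -sumrB; apply: rpred_sum => i Pi.
by case/sgn01P: (x01 i Pi) => ->.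
Qed.

Lemma sum_sgn01_even (T : finType) (P : pred T) (x : T -> int) :
  (forall i, P i -> x i \in sgn01) -> ~~ odd #|[set i | P i & x i != 0%R]| ->
  (2 %| \sum_(i | P i) x i)%Z.
Proof. by move=> /sum_sgn01_parity; lia. Qed.

Lemma even_mxE m n (X : 'M[int]_(m, n)) :
  (forall i j, (2 %| X i j)%Z) -> exists Y, X = 2 *: Y.
Proof.
move=> ev; exists (\matrix_(i, j) (X i j %/ 2)%Z); apply/matrixP => i j.
by rewrite !mxE mulrC divzK.
Qed.

Lemma scale2_inj m n (X Y : 'M[int]_(m, n)) : 2 *: X = 2 *: Y -> X = Y.
Proof.
by move=> /matrixP eqXY; apply/matrixP => i j; have := eqXY i j; rewrite !mxE => /(@mulfI _ 2); apply.
Qed.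

Section UnbalancedHole.

Variables (n : nat) (A S L M : 'M[int]_n).
Hypotheses (n_gt0 : (0 < n)%N) (AS : A *m S = 2%:M) (SA : S *m A = 2%:M).
Hypotheses (S1 : sign_matrix S) (LM : L *m M = 1%:M) (ML : M *m L = 1%:M).
Hypotheses (H01 : forall i j, (L *m A) i j \in sgn01).
Hypothesis (H2 : two_nonzeros_per_line (L *m A)).

Lemma sign_even_sub j j' i : (2 %| S j i - S j' i)%Z.
Proof. by case: (S1 j i) (S1 j' i) => -> [] ->. Qed.

(* Modulo 2 the kernel of [A] consists of the constant vectors, because [S] is
   congruent to the all-ones matrix. *)
Lemma even_mul_const (x : 'cV[int]_n) :
  (forall i, (2 %| ((L *m A) *m x) i ord0)%Z) -> forall j j', (2 %| x j ord0 - x j' ord0)%Z.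
Proof.
move=> ev j j'.
have [b Hx] : exists b, (L *m A) *m x = 2 *: b by apply: even_mxE => i k; rewrite ord1.
have -> : x = S *m (M *m b).
  apply/colP => i; apply: (@mulfI _ 2) => //.
  have Ax : A *m x = M *m (2 *: b) by rewrite -Hx !mulmxA ML mul1mx.
  have /colP/(_ i) : 2 *: x = 2 *: (S *m (M *m b)).
    by rewrite !scalemxAr -Ax mulmxA SA mul_scalar_mx.
  by rewrite !mxE.
rewrite !mxE -sumrB; apply: rpred_sum => i _.
by rewrite -mulrBl dvdz_mulr // sign_even_sub.
Qed.

(** The columns of a smaller two-per-line submatrix would have an indicator vector in the kernel
    modulo 2, hence a constant one; so all columns occur, and a missing row would be zero. For the
    entry sum, let [c] be half the vector of column sums, so that [c S] is the all-ones row times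
    [L]. If the entries of [c] had an even sum, [c S] would be even, and so would be the all-ones
    row [c S M]. *)
Lemma unbalanced_hole_mul : unbalanced_hole (L *m A).
Proof.
have [Hrow Hcol] := H2; have const_ker := even_mul_const.
have [H defH] : exists H, H = L *m A by exists (L *m A).
have H01' := H01; rewrite -defH in H01' Hrow Hcol const_ker *.
split; first split=> //.
- move=> k l f g incf incg k_gt0 l_gt0 lt_kl [Brow Bcol].
  have injf := increasing_inj incf; have injg := increasing_inj incg.
  (* Column [g b] has two nonzeros in the submatrix and two in [H], so none lies outside the rows
     [f]. *)
  have H0 i b : i \notin codom f -> H i (g b) = 0.
    move=> fi; apply/eqP; apply: contraNT fi => Hib.
    have sub : f @: [set a | mxsub f g H a b != 0] \subset [set i | H i (g b) != 0].
      by apply/subsetP => _ /imsetP[a ab ->]; rewrite !inE mxE in ab *.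
    have /eqP eq : f @: [set a | mxsub f g H a b != 0] == [set i | H i (g b) != 0].
      by rewrite eqEcard sub Hcol card_imset // Bcol.
    have : i \in f @: [set a | mxsub f g H a b != 0] by rewrite eq inE.
    by case/imsetP => a _ ->; apply: codom_f.
  pose x : 'cV[int]_n := \col_j (j \in codom g)%:R.
  have HxE i : (H *m x) i 0 = \sum_b H i (g b).
    rewrite mxE (bigID (mem (g @: [set: 'I_l]))) /= [X in _ + X]big1 => [|j].
      rewrite addr0 big_imset /= => [|a b _ _ /injg //].
      by apply: eq_big => [b|b _]; rewrite ?inE // mxE codom_f mulr1.
    apply: contraNeq; rewrite mxE; have [/codomP[b ->] _|] := boolP (j \in codom g).
      by rewrite imset_f.
    by rewrite mulr0 eqxx.
  have ev i : (2 %| (H *m x) i ord0)%Z.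
    rewrite HxE; have [/codomP[a ->]|fi] := boolP (i \in codom f); last first.
      by rewrite big1 // => b _; rewrite H0.
    apply: sum_sgn01_even => [b _|]; first exact: H01'.
    by have := Brow a; under eq_finset => b do rewrite mxE; move=> ->.
  have g_surj j : j \in codom g.
    have := const_ker _ ev j (g (Ordinal l_gt0)).
    by rewrite !mxE codom_f; case: (j \in _).
  have l_n : l = n.
    have := card_codom injg; rewrite (eq_card (B := predT)) => [|j]; last by rewrite g_surj.
    by rewrite !card_ord.
  case: lt_kl => [lt_kn|]; last by rewrite l_n ltnn.
  have [i fi] : exists i, i \notin codom f.
    apply/existsP; apply: contraTT lt_kn; rewrite negb_exists -leqNgt => /forallP f_surj.
    have := card_codom injf; rewrite (eq_card (B := predT)) => [|j].
      by rewrite !card_ord => ->.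
    by have := f_surj j; rewrite negbK => ->.
  have := Hrow i; rewrite (_ : [set j | _] = set0) ?cards0 //.
  by apply/setP => j; rewrite !inE; have /codomP[b ->] := g_surj j; rewrite H0 ?eqxx.
have even_sum (I : finType) (x : I -> int) :
    (forall i, x i \in sgn01) -> #|[set i | x i != 0]| = 2 -> (2 %| \sum_i x i)%Z.
  by move=> x01 x2; apply: sum_sgn01_even => [i _|]; rewrite ?x2.
pose c : 'rV[int]_n := \row_j ((\sum_i H i j) %/ 2)%Z.
have cE : const_mx 1 *m H = 2 *: c.
  apply/rowP => j; rewrite !mxE mulrC divzK; last exact: even_sum.
  by apply: eq_bigr => i _; rewrite mxE mul1r.
have cS : c *m S = const_mx 1 *m L.
  apply/rowP => j; apply: (@mulfI _ 2) => //.
  have /rowP/(_ j) : 2 *: (c *m S) = 2 *: (const_mx 1 *m L).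
    by rewrite scalemxAl -cE defH -!mulmxA AS mul_mx_scalar -scalemxAr.
  by rewrite !mxE.
have sumH : \sum_i \sum_j H i j = 2 * \sum_j c 0 j.
  rewrite exchange_big mulr_sumr; apply: eq_bigr => j _.
  by rewrite mxE mulrC divzK //; apply: even_sum.
apply/eqP; rewrite eqz_mod_dvd sumH.
suff : ~~ (2 %| \sum_j c 0%R j)%Z by lia.
apply/negP => ev_c.
have ev_cS j : (2 %| (c *m S) ord0 j)%Z.
  rewrite mxE.
  have -> : \sum_i c ord0 i * S i j =
            (\sum_i c ord0 i * (S i j - 1)) + \sum_i c ord0 i.
    by rewrite -big_split; apply: eq_bigr => i _ /=; rewrite mulrBr mulr1 subrK.
  rewrite rpredD //; apply: rpred_sum => i _; rewrite dvdz_mull //.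
  by case: (S1 i j) => ->.
pose j0 := Ordinal n_gt0.
have : (2 %| ((c *m S) *m M) ord0 j0)%Z.
  by rewrite mxE; apply: rpred_sum => i _; rewrite dvdz_mulr.
by rewrite cS -mulmxA LM mulmx1 mxE.
Qed.

End UnbalancedHole.

(** Each column has a positive even number of nonzeros, hence at least 2; the rows provide only
    [2 n] in total, so equality holds everywhere. *)
Lemma two_nonzeros_per_line_of_rows n (H : 'M[int]_n) :
  (forall i j, H i j \in sgn01) ->
  (forall i, #|[set j | H i j != 0]| = 2) ->
  (forall j, (2 %| \sum_i H i j)%Z) -> (forall j, exists i, H i j != 0) ->
  two_nonzeros_per_line H.
Proof.
move=> H01 Hrow Hev Hnz; split=> // j.
have cardE (I : finType) (P : pred I) : #|[set i | P i]| = (\sum_i P i)%N.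
  by rewrite -sum1_card big_mkcond; apply: eq_bigr => i _; rewrite inE; case: (P i).
have ge2 j' : (2 <= #|[set i | H i j' != 0%R]|)%N.
  have := @sum_sgn01_parity _ predT (H^~ j') (fun i _ => H01 i j'); have := Hev j'.
  have : (0 < #|[set i | H i j' != 0%R]|)%N.
    by have [i Hi] := Hnz j'; apply/card_gt0P; exists i; rewrite inE.
  by rewrite /=; lia.
have total : (\sum_j' #|[set i | H i j' != 0%R]| = \sum_(j' < n) 2)%N.
  under eq_bigr => j' _ do rewrite cardE.
  rewrite exchange_big; apply: eq_bigr => i _ /=.
  by rewrite -cardE Hrow.
have := leqif_sum (fun j' (_ : true) => leqif_eq (ge2 j')).
move=> [_]; rewrite -total eqxx => /esym/forallP/(_ j) /=.
by move/eqP.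
Qed.

Definition tu_hole m n (A : 'M[int]_(m, n)) :=
  exists p (L : 'M[int]_(p, m)), totally_unimodular L /\ unbalanced_hole (L *m A).

(** Disjoint supports give [v u = 0], so [u v] squares to zero and [1 + u v] inverts [1 - u v]. *)
Lemma tu_hole_rank1 n (A S : 'M[int]_n) (u : 'cV[int]_n) (v : 'rV[int]_n) :
  (0 < n)%N -> A *m S = 2%:M -> S *m A = 2%:M -> sign_matrix S ->
  (forall i, u i 0 \in sgn01) -> (forall i, v 0 i \in sgn01) ->
  (forall i, u i 0 * v 0 i = 0) ->
  (forall i j, ((1%:M - u *m v) *m A) i j \in sgn01) ->
  two_nonzeros_per_line ((1%:M - u *m v) *m A) -> tu_hole A.
Proof.
move=> n_gt0 AS SA S1 u01 v01 uv0 H01 H2.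
have vu0 : v *m u = 0.
  apply/matrixP => i j; rewrite !ord1 !mxE big1 // => k _; by rewrite mulrC uv0.
have uvuv : u *m v *m (u *m v) = 0 by rewrite mulmxA -(mulmxA u) vu0 mulmx0 mul0mx.
exists n, (1%:M - u *m v); split; first exact: totally_unimodular_rank1.
apply: (@unbalanced_hole_mul _ A S _ (1%:M + u *m v)) => //.
  by rewrite mulmxBl mul1mx mulmxDr mulmx1 uvuv addr0 addrK.
by rewrite mulmxDl mul1mx mulmxBr mulmx1 uvuv subr0 subrK.
Qed.

(** Modulo 2 the matrix [S] is all ones, so the sum of row [i] is congruent to the diagonal entry 2
    of [B S]. *)
Lemma even_rows n (B S : 'M[int]_n) : B *m S = 2%:M -> sign_matrix S ->
  forall i, (2 %| \sum_j B i j)%Z.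
Proof.
move=> BS S1 i; have /matrixP/(_ i i) := BS; rewrite !mxE eqxx mulr1n => BSi.
have -> : \sum_j B i j = (\sum_j B i j * (1 - S j i)) + \sum_j B i j * S j i.
  by rewrite -big_split; apply: eq_bigr => j _ /=; rewrite -mulrDr subrK mulr1.
rewrite BSi rpredD //; apply: rpred_sum => j _; rewrite dvdz_mull //.
by case: (S1 j i) => ->.
Qed.

Lemma even_cols n (B S : 'M[int]_n) : S *m B = 2%:M -> sign_matrix S ->
  forall j, (2 %| \sum_i B i j)%Z.
Proof.
move=> SB S1 j; have := @even_rows _ B^T S^T _ _ j.
rewrite -trmx_mul SB tr_scalar_mx; under eq_bigr => i _ do rewrite mxE.
by apply=> // i k; rewrite mxE.
Qed.

(* Rows [r] and [g] of [B] are lowered by [delta] and [rho * delta]. This is left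
   multiplication of [B] by [1 - u v] with [v = delta S / 2], and also right
   multiplication by [1 - y delta] with [y = S u / 2]; the conditions on [S] say
   that the supports are disjoint in both cases. *)
Lemma tu_hole_pivot n (B S : 'M[int]_n) (r g : 'I_n) (rho : int) (delta : 'rV[int]_n) :
  B *m S = 2%:M -> S *m B = 2%:M -> sign_matrix S -> r != g ->
  rho = 1 \/ rho = -1 -> (forall j, delta 0 j \in sgn01) ->
  (forall j, [\/ (delta *m S) 0 j = 0, (delta *m S) 0 j = 2 | (delta *m S) 0 j = -2]) ->
  (delta *m S) 0 r = 0 -> (delta *m S) 0 g = 0 ->
  (forall j, delta 0 j = 0 \/ S j r + rho * S j g = 0) ->
  (forall i j, (B - (delta_mx r 0 + rho *: delta_mx g 0) *m delta) i j \in sgn01) ->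
  (forall i, #|[set j | (B - (delta_mx r 0 + rho *: delta_mx g 0) *m delta) i j != 0]| = 2) ->
  tu_hole B /\ tu_hole B^T.
Proof.
move=> BS SB S1 rg rho1 d01 dS dSr dSg dy.
set u : 'cV[int]_n := _ + _; set H := B - _ => H01 Hrow.
have n_gt0 : (0 < n)%N by apply: leq_ltn_trans (ltn_ord r).
have uE i : u i 0 = (i == r)%:R + rho * (i == g)%:R by rewrite /u !mxE !andbT.
have u01 i : u i 0 \in sgn01.
  rewrite uE; case: eqP => [->|_]; first by rewrite (negPf rg) mulr0.
  by case: eqP => _; case: rho1 => ->.
have [v vE] : exists v, delta *m S = 2 *: v.
  by apply: even_mxE => i j; rewrite ord1; case: (dS j) => ->.
have vj j : 2 * v 0 j = (delta *m S) 0 j by rewrite vE mxE.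
have v01 j : v 0 j \in sgn01.
  by apply/sgn01P; have := vj j; case: (dS j) => -> ?; [constructor 1 | constructor 2 | constructor 3]; lia.
have vB : v *m B = delta.
  by apply: scale2_inj; rewrite scalemxAl -vE -mulmxA SB mul_mx_scalar.
have uv0 i : u i 0 * v 0 i = 0.
  have v0 : (delta *m S) 0 i = 0 -> v 0 i = 0 by have := vj i; lia.
  rewrite uE; case: (eqVneq i r) v0 => [-> /(_ dSr)->|_]; first by rewrite mulr0.
  case: (eqVneq i g) => [-> /(_ dSg)->|_ _]; first by rewrite mulr0.
  by rewrite mulr0 addr0 mul0r.
have LB : (1%:M - u *m v) *m B = H by rewrite mulmxBl mul1mx -mulmxA vB.
have [y yE] : exists y : 'cV[int]_n, S *m u = 2 *: y.
  apply: even_mxE => i j; rewrite ord1 /u mulmxDr -scalemxAr -!colE !mxE.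
  by case: rho1 (S1 i r) (S1 i g) => -> [] -> [] ->.
have yj j : 2 * y j 0 = S j r + rho * S j g.
  by have /colP/(_ j) := yE; rewrite [RHS]mxE => <-; rewrite /u mulmxDr -scalemxAr -!colE !mxE.
have y01 j : y j 0 \in sgn01.
  by apply/sgn01P; have := yj j; case: rho1 (S1 j r) (S1 j g) => -> [] -> [] -> ?;
    first [constructor 1; lia | constructor 2; lia | constructor 3; lia].
have By : B *m y = u by apply: scale2_inj; rewrite scalemxAr -yE mulmxA BS mul_scalar_mx.
have HE : H = B *m (1%:M - y *m delta) by rewrite mulmxBr mulmx1 mulmxA By.
have H2 : two_nonzeros_per_line H.
  apply: two_nonzeros_per_line_of_rows => // [j|j].
    (* The entries of [u] sum to [1 + rho], which is 0 or 2, so column sums stay even. *)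
    have -> : \sum_i H i j = \sum_i B i j - (1 + rho) * delta 0 j.
      rewrite (eq_bigr (fun i => B i j - u i 0 * delta 0 j)) => [|i _].
        rewrite sumrB -mulr_suml; congr (_ - _ * _).
        under eq_bigr => i _ do rewrite uE.
        rewrite big_split -mulr_sumr /=; congr (_ + _).
          by rewrite (bigD1 r) //= eqxx big1 ?addr0 // => i /negPf->.
        by rewrite (bigD1 g) //= eqxx big1 ?addr0 ?mulr1 // => i /negPf->.
      by rewrite /H mxE [X in _ + X]mxE [X in _ - X]mxE big_ord1.
    rewrite rpredB ?(even_cols SB) // dvdz_mulr //; by case: rho1 => ->.
  (* A zero column of [H] would also be one of [B], since [1 + u v] recovers [B] from [H]. *)
  apply/existsP; apply: contraT; rewrite negb_exists => /forallP H0.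
  have Hj : H *m delta_mx j 0 = 0 :> 'cV_n.
    by apply/colP => i; rewrite -colE [LHS]mxE [RHS]mxE; apply/eqP; have := H0 i; rewrite negbK.
  have uvu : v *m u = 0.
    apply/matrixP => a b; rewrite !ord1 !mxE big1 // => k _; by rewrite mulrC uv0.
  have MH : (1%:M + u *m v) *m H = B.
    rewrite -LB mulmxA mulmxDl mul1mx mulmxBr mulmx1 mulmxA -(mulmxA u) uvu.
    by rewrite mulmx0 mul0mx subr0 subrK mul1mx.
  have : S *m (B *m delta_mx j 0) = 0 :> 'cV_n by rewrite -MH -mulmxA Hj !mulmx0.
  rewrite mulmxA SB mul_scalar_mx => /colP/(_ j).
  by rewrite !mxE !eqxx.
split.
  by apply: (@tu_hole_rank1 _ B S u v); rewrite ?LB.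
have tr_tu : (1%:M - delta^T *m y^T) *m B^T = H^T.
  by rewrite HE trmx_mul [(_ - _)^T]raddfB /= trmx1 trmx_mul.
apply: (@tu_hole_rank1 _ B^T S^T delta^T y^T); rewrite ?tr_tu //.
- by rewrite -trmx_mul SB tr_scalar_mx.
- by rewrite -trmx_mul BS tr_scalar_mx.
- by move=> i j; rewrite mxE.
- by move=> i; rewrite mxE.
- by move=> i; rewrite mxE.
- move=> i; rewrite !mxE; have := yj i; case: (dy i) => ->; first by rewrite mul0r.
  by move/eqP; rewrite mulf_eq0 /= => /eqP->; rewrite mulr0.
- by move=> i j; rewrite mxE.
by case: H2 => Hr Hc; split=> i; [rewrite -[RHS](Hc i) | rewrite -[RHS](Hr i)];
  apply: eq_card => j; rewrite !inE [H^T _ _]mxE.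
Qed.

(** * Spikes *)

(** Spikes come from leaves: at a column [p] of degree 1, [S B = 2] expresses column [q] of [S], for
    the edge [q] at [p], through the columns of the big rows, collected in [s]. *)
Definition spike n (S : 'M[int]_n) (s : 'I_n -> int) (p q : 'I_n) :=
  exists2 k : int, k * k = 1 & forall w, S w q = k * (if w == p then - s w else s w).

(* The rows [p1..p4] and columns [q1..q4] form a Hadamard matrix. *)
Lemma no_two_spike_pairs n (S : 'M[int]_n) (s s' : 'I_n -> int)
    (p1 p2 p3 p4 q1 q2 q3 q4 : 'I_n) :
  hadamard_free S -> uniq [:: p1; p2; p3; p4] ->
  spike S s p1 q1 -> spike S s p2 q2 -> spike S s' p3 q3 -> spike S s' p4 q4 ->
  s p1 * s p2 = s' p1 * s' p2 -> s p3 * s p4 = s' p3 * s' p4 -> False.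
Proof.
move=> hfS uniq_p [k1 k1k1 S1] [k2 k2k2 S2] [k3 k3k3 S3] [k4 k4k4 S4] ss12 ss34.
apply: (hfS (tnth [tuple p1; p2; p3; p4]) (tnth [tuple q1; q2; q3; q4])) => a b ab.
have kM k x y : k * k = 1 -> k * x * (k * y) = x * y :> int.
  by move=> kk; rewrite mulrACA kk mul1r.
rewrite !big_ord_recl big_ord0 addr0 !(tnth_nth p1) /= S1 S1 S2 S2 S3 S3 S4 S4 !kM //.
move: uniq_p => /=; rewrite !inE !negb_or !andbT => /andP[/and3P[n12 n13 n14]].
move=> /andP[/andP[n23 n24] n34].
(* Rows from different pairs are orthogonal identically; rows of the same pair need the assumptions
   relating [s] and [s']. *)
case: a b ab => [[|[|[|[|a]]]] // lta] [[|[|[|[|b]]]] // ltb] //= _;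
  rewrite ?eqxx ?(negPf n12) ?(negPf n13) ?(negPf n14) ?(negPf n23) ?(negPf n24) ?(negPf n34)
    ?(eq_sym p2 p1) ?(eq_sym p3 p1) ?(eq_sym p4 p1) ?(eq_sym p3 p2) ?(eq_sym p4 p2) ?(eq_sym p4 p3)
    ?(negPf n12) ?(negPf n13) ?(negPf n14) ?(negPf n23) ?(negPf n24) ?(negPf n34); try ring.
all: by move: ss12 ss34; lia.
Qed.

Lemma card_gt3P (T : finType) (X : {set T}) : (3 < #|X|)%N ->
  exists x y z t, [/\ x \in X, y \in X, z \in X, t \in X & uniq [:: x; y; z; t]].
Proof.
move=> X4; have /card_gt0P[t tX] : (0 < #|X|)%N by lia.
have /card_gt2P[x [y [z [[xX yX zX] [xy yz zx]]]]] : (2 < #|X :\ t|)%N.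
  by move: X4; rewrite (cardsD1 t) tX.
move: xX yX zX; rewrite !inE => /andP[xt xX] /andP[yt yX] /andP[zt zX].
by exists x, y, z, t; split; rewrite //= !inE !negb_or xy yz xt yt zt eq_sym zx.
Qed.

(** Four spikes of one vector split into two pairs, with trivial sign conditions because
    [s' = s]. *)
Lemma spikes_card_le3 n (S : 'M[int]_n) s (X : {set 'I_n}) :
  hadamard_free S -> (forall p, p \in X -> exists q, spike S s p q) -> (#|X| <= 3)%N.
Proof.
move=> hfS spX; rewrite leqNgt; apply/negP => /card_gt3P[x [y [z [t []]]]].
move=> /spX[q1 sp1] /spX[q2 sp2] /spX[q3 sp3] /spX[q4 sp4] uniq4.
exact: no_two_spike_pairs hfS uniq4 sp1 sp2 sp3 sp4 erefl erefl.
Qed.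

(** The product [h w * h' w] has two possible values, so two of any three elements share it. *)
Lemma sign_pigeonhole (T : finType) (X : {set T}) (h h' : T -> int) :
  (2 < #|X|)%N -> (forall w, h w = 1 \/ h w = -1) -> (forall w, h' w = 1 \/ h' w = -1) ->
  exists x y, [/\ x \in X, y \in X, x != y & h x * h y = h' x * h' y].
Proof.
move=> /card_gt2P[x [y [z [[xX yX zX] [xy yz zx]]]]] h1 h1'.
have [exy | nxy] := eqVneq (h x * h y) (h' x * h' y); first by exists x, y.
have [eyz | nyz] := eqVneq (h y * h z) (h' y * h' z); first by exists y, z.
exists z, x; split=> //; move: nxy nyz.
by case: (h1 x) (h1 y) (h1 z) (h1' x) (h1' y) (h1' z) => -> [] -> [] -> [] -> [] -> [] ->.
Qed.

(** The pigeonhole argument selects in each set a pair on which [s] and [s'] have equal sign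
    products; the two pairs span a Hadamard block. *)
Lemma spikes_disjoint n (S : 'M[int]_n) s s' (X X' : {set 'I_n}) :
  hadamard_free S ->
  (forall w, s w = 1 \/ s w = -1) -> (forall w, s' w = 1 \/ s' w = -1) ->
  (forall p, p \in X -> exists q, spike S s p q) ->
  (forall p, p \in X' -> exists q, spike S s' p q) ->
  (2 < #|X|)%N -> (2 < #|X'|)%N -> [disjoint X & X'] -> False.
Proof.
move=> hfS s1 s1' spX spX' X3 X3' dXX'.
have [x [y [xX yX xy sxy]]] := sign_pigeonhole X3 s1 s1'.
have [z [t [zX tX zt szt]]] := sign_pigeonhole X3' s1 s1'.
have [q1 sp1] := spX x xX; have [q2 sp2] := spX y yX.
have [q3 sp3] := spX' z zX; have [q4 sp4] := spX' t tX.
have neq a b : a \in X -> b \in X' -> a != b.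
  by move=> aX bX; apply: contraTneq aX => ->; rewrite (disjointFl dXX').
apply: (no_two_spike_pairs hfS _ sp1 sp2 sp3 sp4 sxy szt).
by rewrite /= !inE !negb_or xy zt !neq.
Qed.

(** * Degrees *)

Lemma card_nonzero_even (T : finType) (x : T -> int) :
  (forall i, x i \in sgn01) -> (2 %| \sum_i x i)%Z -> ~~ odd #|[set i | x i != 0]|.
Proof.
move=> x01; have := @sum_sgn01_parity _ (fun=> true) x (fun i _ => x01 i).
rewrite /=; lia.
Qed.

(** What the combinatorial part keeps of almost total unimodularity. [B] will be a transposed
    incidence matrix, with the hyperedges as rows. *)
Record half_inverse_pair n (B S : 'M[int]_n) := HalfInversePair {
  half_inv_mulr : B *m S = 2%:M;
  half_inv_mull : S *m B = 2%:M;
  half_inv_sign : sign_matrix S;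
  half_inv_hf : hadamard_free S;
  half_inv_sgn01 : forall i j, B i j \in sgn01
}.

Section Rows.

Variables (n : nat) (B S : 'M[int]_n).
Hypothesis BSP : half_inverse_pair B S.

Let S1 := half_inv_sign BSP.
Let B01 := half_inv_sgn01 BSP.

Definition supp (i : 'I_n) : {set 'I_n} := [set u | B i u != 0].
(** Supports turn out even and nonempty, so these rows have at least 4 elements and fall under the
    disjointness or laminarity assumption. *)
Definition big : {set 'I_n} := [set i | #|supp i| != 2].
(** [deg] is the degree in the graph formed by the rows of size 2, [dep] the depth in the family of
    big rows. *)
Definition deg (u : 'I_n) : nat := #|[set i in ~: big | B i u != 0]|.
Definition dep (u : 'I_n) : nat := #|[set i in big | B i u != 0]|.

Lemma half_inv_row i j : \sum_u B i u * S u j = 2 * (i == j)%:R.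
Proof. by have /matrixP/(_ i j) := half_inv_mulr BSP; rewrite !mxE => ->; case: eqP. Qed.

Lemma half_inv_col w u : \sum_i S w i * B i u = 2 * (w == u)%:R.
Proof. by have /matrixP/(_ w u) := half_inv_mull BSP; rewrite !mxE => ->; case: eqP. Qed.

Lemma nz_sign i u : B i u != 0 -> B i u = 1 \/ B i u = -1.
Proof. by case/sgn01P: (B01 i u) => -> // _; [left | right]. Qed.

Lemma row_sum_supp i (F : 'I_n -> int) :
  \sum_u B i u * F u = \sum_(u in supp i) B i u * F u.
Proof.
rewrite [RHS]big_mkcond; apply: eq_bigr => u _; rewrite inE.
by case: eqP => // ->; rewrite mul0r.
Qed.

Lemma supp_even i : ~~ odd #|supp i|.
Proof. by apply: card_nonzero_even => //; apply: even_rows (half_inv_mulr BSP) S1 i. Qed.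

Lemma supp_neq0 i : (0 < #|supp i|)%N.
Proof.
rewrite lt0n; apply/negP => /eqP/cards0_eq supp0.
by have := half_inv_row i i; rewrite row_sum_supp supp0 big_set0 eqxx.
Qed.

Lemma big_supp_ge4 i : i \in big -> (4 <= #|supp i|)%N.
Proof. by rewrite inE; have := supp_even i; have := supp_neq0 i; lia. Qed.

Lemma notin_big i : i \notin big -> #|supp i| = 2.
Proof. by rewrite inE negbK => /eqP. Qed.

Lemma deg_dep u : (deg u + dep u)%N = #|[set i | B i u != 0]|.
Proof.
rewrite -(cardsID big [set i | _]) addnC; congr (_ + _)%N; apply: eq_card => i;
  by rewrite !inE andbC.
Qed.

Lemma deg_dep_even u : ~~ odd (deg u + dep u).
Proof.
rewrite deg_dep; apply: card_nonzero_even => // .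
exact: even_cols (half_inv_mull BSP) S1 u.
Qed.

Lemma deg_dep_gt0 u : (0 < deg u + dep u)%N.
Proof.
rewrite deg_dep lt0n; apply/negP => /eqP/cards0_eq supp0.
have := half_inv_col u u; rewrite eqxx big1 // => i _.
by move/setP/(_ i): supp0; rewrite !inE => /negbFE/eqP->; rewrite mulr0.
Qed.

(** Handshake identity for a graph with [n] vertices and [n - #|big|] edges. *)
Lemma sum_deg : \sum_u (2 - (deg u)%:Z) = 2 * #|big|%:Z.
Proof.
have -> : \sum_u (2 - (deg u)%:Z) = 2 * n%:Z - (\sum_u deg u)%N%:Z.
  rewrite sumrB sumr_const card_ord (big_morph _ PoszD erefl); congr (_ - _).
  by rewrite -[LHS]mulr_natr; congr (_ * _); apply: natz.
have -> : (\sum_u deg u = #|~: big| * 2)%N.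
  transitivity (\sum_u \sum_(i in ~: big) (B i u != 0%R))%N.
    apply: eq_bigr => u _; rewrite /deg -sum1_card big_mkcond [RHS]big_mkcond.
    by apply: eq_bigr => i _; rewrite !inE; case: (~~ _); case: (B i u == 0).
  rewrite exchange_big -sum_nat_const; apply: eq_bigr => i; rewrite !inE negbK => /eqP supp2.
  rewrite -[RHS]supp2.
  by rewrite -sum1_card [RHS]big_mkcond; apply: eq_bigr => u _; rewrite inE; case: (B i u == 0).
have := cardsC big; rewrite card_ord; lia.
Qed.

(** Column [u] of [S B = 2] involves, besides big rows, only the edge [f] at the leaf [u]. *)
Lemma deg1P u : deg u = 1 -> exists2 f, f \notin big & B f u != 0 /\ forall w,
  \sum_(i in big) S w i * B i u + S w f * B f u = 2 * (w == u)%:R.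
Proof.
move=> /eqP/cards1P[f fE]; have : f \in [set f] by rewrite inE.
rewrite -fE !inE negbK => /andP[f2 Bfu]; exists f; first by rewrite inE f2.
split=> // w; rewrite -half_inv_col [RHS](bigID (mem big)) /=; congr (_ + _).
rewrite (bigD1 f) /=; last by rewrite inE f2.
rewrite [X in _ = _ + X]big1 ?addr0 // => i /andP[nbi fi].
have : i \notin [set f] by rewrite inE.
by rewrite -fE in_set in_setC nbi negbK => /eqP->; rewrite mulr0.
Qed.

Lemma deg0P u : deg u = 0 -> forall w, \sum_(i in big) S w i * B i u = 2 * (w == u)%:R.
Proof.
move=> /eqP; rewrite cards_eq0 => /eqP d0 w.
rewrite -half_inv_col [RHS](bigID (mem big)) /= [X in _ = _ + X]big1 ?addr0 // => i nbi.
by move/setP/(_ i): d0; rewrite in_set in_setC nbi in_set0 => /negbFE/eqP->; rewrite mulr0.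
Qed.

End Rows.

(** * Reduction to a hole *)

Section Constructions.

Variables (n : nat) (B S : 'M[int]_n).
Hypothesis BSP : half_inverse_pair B S.

Let BS := half_inv_mulr BSP.
Let SB := half_inv_mull BSP.
Let S1 := half_inv_sign BSP.
Let B01 := half_inv_sgn01 BSP.

(** [B] itself is already a hole here; the identity serves as the rank-one update with
    [u = v = 0]. *)
Lemma tu_hole_graph : (0 < n)%N -> big B = set0 -> tu_hole B /\ tu_hole B^T.
Proof.
move=> n_gt0 nobig.
have H2 : two_nonzeros_per_line B.
  apply: two_nonzeros_per_line_of_rows => // [i|j|j].
  - by have := in_set0 i; rewrite -nobig inE => /negbFE/eqP.
  - exact: even_cols SB S1 j.
  have := deg_dep_gt0 BSP j; rewrite deg_dep => /card_gt0P[i]; rewrite inE => Bij.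
  by exists i.
have id_hole m (A T : 'M[int]_m) : (0 < m)%N -> A *m T = 2%:M -> T *m A = 2%:M ->
    sign_matrix T -> (forall i j, A i j \in sgn01) -> two_nonzeros_per_line A -> tu_hole A.
  move=> m_gt0 AT TA T1 A01 A2; have L1 : (1%:M - 0 *m 0) *m A = A.
    by move=> p; rewrite mulmx0 subr0 mul1mx.
  apply: (@tu_hole_rank1 _ A T 0 0) => //; rewrite ?L1 //;
    by move=> i; rewrite !mxE ?mul0r.
split; first exact: id_hole BS SB S1 B01 H2.
apply: (id_hole _ _ S^T) => //.
- by rewrite -trmx_mul SB tr_scalar_mx.
- by rewrite -trmx_mul BS tr_scalar_mx.
- by move=> i j; rewrite mxE.
- by move=> i j; rewrite mxE.
case: H2 => Hr Hc; split=> i; [rewrite -[RHS](Hc i) | rewrite -[RHS](Hr i)];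
  by apply: eq_card => j; rewrite !inE mxE.
Qed.

(** At [w = u] the leaf relation is a sum of two signs equal to 2, so both are 1. *)
Lemma leaf_sign r u : big B = [set r] -> B r u != 0 -> deg B u = 1 -> B r u = S u r.
Proof.
move=> bigr Bru /(deg1P BSP)[f _ [Bfu /(_ u)]]; rewrite bigr big_set1 eqxx.
move: (nz_sign BSP Bru) (nz_sign BSP Bfu) (S1 u r) (S1 u f).
by do 4![case=> ->].
Qed.

(* In the graph [c] joins the three leaves [X]. Among them [d] is chosen on the
   side of [c] of an edge [g = {c, b}], and [delta] is the part of row [r] on
   [{c, d}]. *)
Lemma tu_hole_tripod r c (X : {set 'I_n}) :
  big B = [set r] -> c \notin X -> supp B r = c |: X -> #|X| = 3 ->
  (forall u, u \in X -> deg B u = 1) -> tu_hole B /\ tu_hole B^T.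
Proof.
move=> bigr cX suppr X3 degX.
have Br u : (B r u != 0) = (u \in c |: X) by rewrite -suppr inE.
have BrX u : u \in X -> B r u = S u r.
  by move=> uX; apply: leaf_sign (degX u uX); rewrite // Br inE uX orbT.
have row_r j : B r c * S c j + \sum_(u in X) S u r * S u j = 2 * (r == j)%:R.
  rewrite -(half_inv_row BSP) row_sum_supp suppr big_setU1 //=; congr (_ + _).
  by apply: eq_bigr => u uX; rewrite BrX.
(* In the diagonal entry 2 of [B S] the three leaves contribute 3, so [c] contributes -1. *)
have Scr : S c r = - B r c.
  have := row_r r; rewrite eqxx (eq_bigr (fun=> 1)) => [|u _]; last exact: sign_mul_self.
  rewrite sumr_const X3; have Brc : B r c != 0 by rewrite Br setU11.
  by case: (nz_sign BSP Brc) (S1 c r) => -> [] ->.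
have Brc1 : B r c = 1 \/ B r c = -1 by apply: (nz_sign BSP); rewrite Br setU11.
(* Row [r] contributes -1 to the diagonal entry 2 of [S B] at [c], so some other term is
   positive. *)
have [g gr Scg] : exists2 g, g != r & S c g * B g c = 1.
  have := half_inv_col BSP c c; rewrite (bigD1 r) //= eqxx mulr1 Scr mulNr sign_mul_self // => sum3.
  have [g /andP[gr /eqP Scg]|no_g] := pickP (fun g => (g != r) && (S c g * B g c == 1)).
    by exists g.
  suff : \sum_(i | i != r) S c i * B i c <= 0.
    by move: sum3; move: (\sum_(i | i != r) _) => t; lia.
  apply: sumr_le0 => i ir; have := no_g i; rewrite ir /=.
  by case: (S1 c i) (sgn01P _ (B01 i c)) => -> [] ->.
have g2 : #|supp B g| = 2.
  by apply: notin_big; rewrite bigr inE.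
have Bgc : B g c = S c g.
  by move: Scg; case/sgn01P: (B01 g c) => ->; case: (S1 c g) => ->.
have [b bc suppg] : exists2 b, b != c & supp B g = [set c; b].
  have /cards1P[b bE] : #|supp B g :\ c| == 1%N.
    move: g2; rewrite (cardsD1 c) inE Bgc; by case: (S1 c g) => ->; rewrite /= add1n => -[] ->.
  have bg : b \in supp B g :\ c by rewrite bE set11.
  exists b; first by move: bg; rewrite !inE => /andP[].
  rewrite -[LHS](setD1K (a := c)) ?bE // inE Bgc; by case: (S1 c g) => ->.
have row_g j : S c g * S c j + B g b * S b j = 2 * (g == j)%:R.
  by rewrite -(half_inv_row BSP) row_sum_supp suppg big_setU1 ?inE 1?eq_sym //= big_set1 Bgc.
have Bgb : B g b = S b g.
  have := row_g g; rewrite eqxx sign_mul_self //.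
  by case/sgn01P: (B01 g b) => ->; case: (S1 b g) => ->.
(* With this sign, subtracting [rho * delta] from row [g] clears its entry at [c]. *)
pose rho := S c g * B r c.
have rho1 : rho = 1 \/ rho = -1.
  by rewrite /rho; case: (S1 c g) Brc1 => -> [] ->; [left|right|right|left].
(* Row [r] of [B] is orthogonal to column [g] of [S]; as [c] contributes [rho], the leaves cannot
   all do so. *)
have [d dX Sd] : exists2 d, d \in X & S d r * S d g = - rho.
  have [d /andP[dX /eqP Sd]|no_d] := pickP (fun d => (d \in X) && (S d r * S d g == - rho)).
    by exists d.
  have := row_r g; rewrite eq_sym (negPf gr) (eq_bigr (fun=> rho)) => [|u uX].
    by rewrite sumr_const X3 /rho; case: Brc1 (S1 c g) => -> [] ->.
  by have := no_d u; rewrite uX /=; case: rho1 (S1 u r) (S1 u g) => -> [] -> [] ->.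
have dc : d != c by apply: contraNneq cX => <-.
have db : d != b.
  apply/eqP => db; have := row_g r; rewrite (negPf gr) mulr0 Bgb -db Scr.
  move: Sd; rewrite /rho.
  by case: (S1 c g) (S1 d g) (S1 d r) Brc1 => -> [] -> [] -> [] ->.
have Brd : B r d = S d r by apply: BrX.
pose delta : 'rV[int]_n := \row_j ((j == c)%:R * B r c + (j == d)%:R * B r d).
have dS j : (delta *m S) 0 j = B r c * S c j + B r d * S d j.
  rewrite mxE (eq_bigr (fun k => (k == c)%:R * (B r c * S k j) + (k == d)%:R * (B r d * S k j))).
    rewrite big_split /=; congr (_ + _).
      by rewrite (bigD1 c) //= eqxx mul1r big1 ?addr0 // => k /negPf->; rewrite mul0r.
    by rewrite (bigD1 d) //= eqxx mul1r big1 ?addr0 // => k /negPf->; rewrite mul0r.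
  by move=> k _; rewrite mxE; ring.
have dE j : delta 0 j = if j == c then B r c else if j == d then B r d else 0.
  rewrite mxE; case: (eqVneq j c) => [->|_]; first by rewrite eq_sym (negPf dc) mul0r addr0 mul1r.
  by rewrite mul0r add0r; case: eqP; rewrite ?mul1r ?mul0r.
have HE i j : (B - (delta_mx r 0 + rho *: delta_mx g 0) *m delta) i j =
    B i j - ((i == r)%:R + rho * (i == g)%:R) * delta 0 j.
  by rewrite [LHS]mxE [X in _ + X]mxE [X in _ - X]mxE big_ord1 !mxE !andbT.
(* After the pivot, row [r] keeps the two leaves other than [d], and row [g] becomes an edge joining
   [b] and [d]. *)
have Hr j : B r j - ((r == r)%:R + rho * (r == g)%:R) * delta 0 j =
    if j \in X :\ d then B r j else 0.
  rewrite eqxx [r == g]eq_sym (negPf gr) mulr0 addr0 mul1r dE !inE.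
  have [->|jc] := eqVneq j c; first by rewrite (negPf cX) andbF subrr.
  have [->|jd] := eqVneq j d; first by rewrite subrr.
  have := Br j; rewrite !inE (negPf jc) /= subr0.
  by case: (j \in X) => // /eqP->.
have Hg j : B g j - ((g == r)%:R + rho * (g == g)%:R) * delta 0 j =
    if j == b then B g b else if j == d then - rho * B r d else 0.
  rewrite (negPf gr) eqxx mulr1 add0r dE.
  have [->|jb] := eqVneq j b; first by rewrite (negPf bc) eq_sym (negPf db) mulr0 subr0.
  have Bgj : j != c -> B g j = 0.
    move=> jc; apply/eqP; have : j \notin supp B g by rewrite suppg !inE negb_or jc.
    by rewrite inE negbK.
  have [->|jc] := eqVneq j c.
    rewrite eq_sym (negPf dc) Bgc /rho -mulrA sign_mul_self // mulr1 subrr //.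
  rewrite Bgj //; case: eqP => _; last by rewrite mulr0 subr0.
  by rewrite mulNr sub0r.
have Hother i j : i != r -> i != g -> B i j - ((i == r)%:R + rho * (i == g)%:R) * delta 0 j = B i j.
  by move=> /negPf-> /negPf->; rewrite mulr0 addr0 mul0r subr0.
have d0 j : j != c -> j != d -> delta 0 j = 0 by rewrite dE => /negPf-> /negPf->.
apply: (@tu_hole_pivot _ B S r g rho delta) => //.
- by rewrite eq_sym.
- by move=> j; rewrite dE; case: eqP => // _; case: eqP.
- move=> j; rewrite dS Brd; case: Brc1 (S1 c j) (S1 d r) (S1 d j) => -> [] -> [] -> [] ->;
  by [constructor 1 | constructor 2 | constructor 3].
- by rewrite dS Scr Brd mulrN !sign_mul_self.
- by rewrite dS Brd Sd /rho mulrC subrr.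
- move=> j; have [->|jc] := eqVneq j c; first right.
    by rewrite Scr /rho mulrAC sign_mul_self // mul1r addNr.
  have [->|jd] := eqVneq j d; [right | by left; rewrite d0].
  by move: Sd; case: rho1 (S1 d r) (S1 d g) => -> [] -> [] ->.
- move=> i j.
  have [->|ir] := eqVneq i r; first by rewrite HE Hr; case: ifP.
  have [->|ig] := eqVneq i g; last by rewrite HE Hother.
  rewrite HE Hg; case: ifP => // _; case: ifP => // _.
  by rewrite mulNr; apply/sgn01N/sgn01M => //; case: rho1 => ->.
move=> i; have [->|ir] := eqVneq i r.
  transitivity #|X :\ d|; last by have := cardsD1 d X; rewrite dX X3 => -[].
  apply: eq_card => j; rewrite inE HE Hr; case: ifP => //.
  by rewrite Br !inE => /andP[_ ->]; rewrite orbT.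
have [->|ig] := eqVneq i g.
  transitivity #|[set b; d]|; last by rewrite cards2 eq_sym db.
  apply: eq_card => j; rewrite !inE HE Hg.
  have [_|_] := eqVneq j b; first by rewrite Bgb; case: (S1 b g) => ->.
  have [_|_] := eqVneq j d; last by rewrite eqxx.
  by rewrite Brd; case: rho1 (S1 d r) => -> [] ->.
transitivity #|supp B i|.
  by apply: eq_card => j; rewrite !inE HE Hother.
by apply: notin_big; rewrite bigr inE.
Qed.

End Constructions.

(** Rows [r] and [s] are both lowered by row [r] without its entries at [v] and [x], which leaves
    them supported on [{v, x}] and [{v, x'}]. Because [v] is isolated, columns [r] and [s] of [S]
    are opposite except at [v], as the pivot requires. *)
Lemma tu_hole_nested n (B S : 'M[int]_n) r s v x x' :
  half_inverse_pair B S ->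
  r != s -> big B = [set r; s] ->
  (forall i j, B i j = 0 \/ B i j = 1) -> x != x' ->
  x \notin supp B s -> x' \notin supp B s ->
  supp B r = [set x; x'] :|: supp B s -> v \in supp B s ->
  deg B v = 0 -> deg B x = 1 -> tu_hole B /\ tu_hole B^T.
Proof.
move=> BSP rs bigE Bnn xx' xs x's suppr vs degv degx.
have [BS SB S1] := And3 (half_inv_mulr BSP) (half_inv_mull BSP) (half_inv_sign BSP).
have Bs j : B s j = (j \in supp B s)%:R by rewrite inE; case: (Bnn s j) => ->.
have Br j : B r j = (j \in [set x; x'] :|: supp B s)%:R.
  by rewrite -suppr inE; case: (Bnn r j) => ->.
have vx : v != x by apply: contraNneq xs => <-.
have vx' : v != x' by apply: contraNneq x's => <-.
have [xv x'v] : x != v /\ x' != v by rewrite ![_ == v]eq_sym.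
have sum_big (F : 'I_n -> int) : \sum_(i in big B) F i = F r + F s.
  by rewrite bigE big_setU1 ?inE //= big_set1.
have Srs w : S w r + S w s = 2 * (w == v)%:R.
  by rewrite -(deg0P BSP degv) sum_big Br Bs in_setU vs orbT !mulr1.
have [f _ [Bfx Sx]] := deg1P BSP degx.
have {}Sx w : S w r + S w f * B f x = 2 * (w == x)%:R.
  by rewrite -Sx sum_big Br Bs in_setU in_set2 eqxx (negPf xs) mulr1 mulr0 addr0.
have Bfx1 : B f x = 1 by case: (Bnn f x) Bfx => ->.
have [Svr Svs] : S v r = 1 /\ S v s = 1.
  by have := Srs v; rewrite eqxx; case: (S1 v r) (S1 v s) => -> [] ->.
have Sxr : S x r = 1.
  by have := Sx x; rewrite eqxx Bfx1 !mulr1; case: (S1 x r) (S1 x f) => -> [] ->.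
have Sxs : S x s = -1.
  by have := Srs x; rewrite eq_sym (negPf vx) Sxr; case: (S1 x s) => ->.
pose delta : 'rV[int]_n := \row_j (B r j - (j == v)%:R - (j == x)%:R).
have sum1 a j : \sum_k (k == a)%:R * S k j = S a j.
  by rewrite (bigD1 a) //= eqxx mul1r big1 ?addr0 // => k /negPf->; rewrite mul0r.
have dS j : (delta *m S) 0 j = 2 * (r == j)%:R - S v j - S x j.
  rewrite mxE -(half_inv_row BSP) -(sum1 v) -(sum1 x) -!sumrB.
  by apply: eq_bigr => k _; rewrite mxE !mulrBl.
have dE j : delta 0 j = ((j \in supp B s) && (j != v) || (j == x'))%:R.
  rewrite mxE Br in_setU in_set2; have [->|jx] := eqVneq j x.
    by rewrite (negPf xx') (negPf xs) (negPf xv).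
  have [->|jx'] := eqVneq j x'; first by rewrite !orbT (negPf x'v).
  rewrite subr0 /=; have [->|jv] := eqVneq j v; last by rewrite andbT orbF subr0.
  by rewrite vs.
have HE i j : (B - (delta_mx r 0 + 1 *: delta_mx s 0) *m delta) i j =
    B i j - ((i == r)%:R + (i == s)%:R) * delta 0 j.
  by rewrite [LHS]mxE [X in _ + X]mxE [X in _ - X]mxE big_ord1 scale1r !mxE !andbT.
have Hr j : (B - (delta_mx r 0 + 1 *: delta_mx s 0) *m delta) r j = (j \in [set v; x])%:R.
  rewrite HE eqxx (negPf rs) addr0 mul1r mxE in_set2.
  rewrite -addrA -opprD opprB addrC subrK.
  by have [->|_] := eqVneq j v; rewrite ?(negPf vx) ?add0r ?addr0.
have Hs j : (B - (delta_mx r 0 + 1 *: delta_mx s 0) *m delta) s j =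
    (j == v)%:R - (j == x')%:R.
  rewrite HE eqxx eq_sym (negPf rs) add0r mul1r dE Bs.
  have [->|jx'] := eqVneq j x'; first by rewrite (negPf x's) (negPf x'v).
  have [->|jv] := eqVneq j v; first by rewrite vs andbF.
  by rewrite andbT orbF !subrr.
have Hother i j : i != r -> i != s ->
    (B - (delta_mx r 0 + 1 *: delta_mx s 0) *m delta) i j = B i j.
  by rewrite HE => /negPf-> /negPf->; rewrite addr0 mul0r subr0.
apply: (@tu_hole_pivot _ B S r s 1 delta) => //; first by left.
- by move=> j; rewrite dE; case: (_ || _).
- move=> j; rewrite dS; have [<-|jr] := eqVneq r j; first by constructor 1; rewrite Svr Sxr.
  by case: (S1 v j) (S1 x j) => -> [] ->; [constructor 3|constructor 1|constructor 1|constructor 2].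
- by rewrite dS eqxx Svr Sxr.
- by rewrite dS (negPf rs) Svs Sxs.
- move=> j; have [->|jv] := eqVneq j v; first by left; rewrite dE vs eqxx (negPf vx').
  by right; rewrite mul1r Srs (negPf jv) mulr0.
- move=> i j.
  have [->|ir] := eqVneq i r; first by rewrite Hr; case: (j \in _).
  have [->|is_] := eqVneq i s; last by rewrite Hother // (half_inv_sgn01 BSP).
  by rewrite Hs; do 2!case: eqP => _.
move=> i; have [->|ir] := eqVneq i r.
  transitivity #|[set v; x]|; last by rewrite cards2 vx.
  by apply: eq_card => j; rewrite inE Hr; case: (j \in _).
have [->|is_] := eqVneq i s.
  transitivity #|[set v; x']|; last by rewrite cards2 vx'.
  apply: eq_card => j; rewrite !inE Hs.
  have [->|_] := eqVneq j v; first by rewrite (negPf vx').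
  by have [_|_] := eqVneq j x'.
transitivity #|supp B i|; first by apply: eq_card => j; rewrite !inE Hother.
by apply: notin_big; rewrite bigE !inE negb_or ir.
Qed.

(** * Disjoint big rows *)

(** The total [2 * #|K|] can only be reached if every one of the disjoint cells attains its bound 2,
    since nothing outside them is positive. *)
Lemma tight_cells (T : finType) (K : {set T}) (cell : T -> pred T) (c : T -> int) :
  \sum_u c u = 2 * #|K|%:Z ->
  (forall u, (forall i, i \in K -> ~~ cell i u) -> c u <= 0) ->
  (forall i j u, i \in K -> j \in K -> cell i u -> cell j u -> i = j) ->
  (forall i, i \in K -> \sum_(u | cell i u) c u <= 2) ->
  forall i, i \in K -> \sum_(u | cell i u) c u = 2.
Proof.
move=> sumc nocell cell_uniq cell2 i iK.
have le_c u : c u <= \sum_(i in K | cell i u) c u.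
  have [j /andP[jK ju]|no_j] := pickP (fun j => (j \in K) && cell j u).
    rewrite (bigD1 j) ?jK //= big1 ?addr0 // => k /andP[/andP[kK ku] /negP[]].
    by apply/eqP; apply: cell_uniq ku ju.
  rewrite big_pred0 //; apply: nocell => j jK; have := no_j j.
  by rewrite jK /= => ->.
have sum0 : \sum_(j in K) (2 - \sum_(u | cell j u) c u) = 0.
  apply/eqP; rewrite eq_le sumr_ge0 ?andbT => [|j jK]; last by rewrite subr_ge0 cell2.
  have -> : \sum_(j in K) (2 - \sum_(u | cell j u) c u) =
            \sum_u c u - \sum_u \sum_(j in K | cell j u) c u.
    rewrite [X in _ = _ - X](exchange_big_dep (mem K)) /= => [|u j _ /andP[]//].
    rewrite sumrB sumr_const sumc -[2 *+ _]mulr_natr.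
    congr (_ - _); first by congr (_ * _); rewrite natz.
    by apply: eq_bigr => j jK; apply: eq_bigl => u; rewrite jK.
  by rewrite subr_le0; apply: ler_sum => u _.
have /psumr_eq0P/(_ sum0)/(_ i iK)/eqP : forall j, j \in K -> 0 <= 2 - \sum_(u | cell j u) c u.
  by move=> j jK; rewrite subr_ge0 cell2.
by rewrite subr_eq0 => /eqP.
Qed.

(** Away from [u] column [f] is [-(e * b)] times [s]; at [u] both terms equal 1, which flips the
    sign there. *)
Lemma spikeI n (S : 'M[int]_n) (s : 'I_n -> int) u f (e b : int) :
  sign_matrix S -> e = 1 \/ e = -1 -> b = 1 \/ b = -1 -> s u = 1 \/ s u = -1 ->
  (forall w, s w * e + S w f * b = 2 * (w == u)%:R) -> spike S s u f.
Proof.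
move=> S1 e1 b1 su eqS; exists (- (e * b)).
  by case: e1 b1 => -> [] ->.
move=> w; have := eqS w; have [->|_] := eqVneq w u; rewrite ?mulr1 ?mulr0.
  by case: e1 b1 su (S1 u f) => -> [] -> [] -> [] ->.
by case: e1 b1 => -> [] ->; lia.
Qed.

Section CellBounds.

Variables (n : nat) (B S : 'M[int]_n).
Hypothesis BSP : half_inverse_pair B S.

Definition leaves (X : {set 'I_n}) := [set u in X | deg B u == 1%N].

(** A leaf contributes 1, a column of larger odd degree at most -1. *)
Lemma odd_cell_bound (X : {set 'I_n}) :
  (forall u, u \in X -> odd (deg B u)) ->
  \sum_(u in X) (2 - (deg B u)%:Z) <= 2 * #|leaves X|%:Z - #|X|%:Z.
Proof.
move=> oddX.
have -> : 2 * #|leaves X|%:Z - #|X|%:Z = \sum_(u in X) (2 * (deg B u == 1%N)%:R - 1).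
  rewrite sumrB -mulr_sumr sumr_const; congr (2 * _ - _); last by rewrite natz.
  rewrite -sum1_card (big_morph _ PoszD erefl) big_mkcond [RHS]big_mkcond.
  by apply: eq_bigr => u _; rewrite inE; case: (u \in X); case: (_ == _).
apply: ler_sum => u /oddX; case: eqP => [->//|]; lia.
Qed.

(** Outside the big rows the degree is even and positive. *)
Lemma deg_no_big u : (forall i, i \in big B -> B i u = 0) -> 2 - (deg B u)%:Z <= 0.
Proof.
move=> nobig; have := deg_dep_even BSP u; have := deg_dep_gt0 BSP u.
have -> : dep B u = 0%N; last by lia.
by apply/eqP; rewrite cards_eq0; apply/eqP/setP => i; rewrite !inE;
  apply/negP => /andP[ib]; rewrite nobig ?eqxx // inE.
Qed.

End CellBounds.

Section DisjointRows.

Variables (n : nat) (B S : 'M[int]_n).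
Hypothesis BSP : half_inverse_pair B S.

Let S1 := half_inv_sign BSP.

Hypothesis disjB : forall i j, i \in big B -> j \in big B -> i != j ->
  [disjoint supp B i & supp B j].

Lemma disjoint_big_eq i j u :
  i \in big B -> j \in big B -> u \in supp B i -> u \in supp B j -> i = j.
Proof.
move=> ib jb ui uj; apply/eqP; apply: contraT => ij.
by have := disjointFr (disjB ib jb ij) ui; rewrite uj.
Qed.

Lemma disjoint_deg_odd i u : i \in big B -> u \in supp B i -> odd (deg B u).
Proof.
move=> ib ui; have := deg_dep_even BSP u.
suff -> : dep B u = 1%N by rewrite addn1 /= negbK.
apply/eqP/cards1P; exists i; apply/setP => j; rewrite in_set in_set1.
apply/andP/eqP => [[jb uj]|->]; last by rewrite ib; move: ui; rewrite inE.
by apply: (disjoint_big_eq jb ib _ ui); rewrite inE.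
Qed.

Lemma disjoint_leaf_spike i u :
  i \in big B -> u \in leaves B (supp B i) -> exists f, spike S (S^~ i) u f.
Proof.
move=> ib; rewrite inE => /andP[ui /eqP/(deg1P BSP)[f _ [Bfu Sfu]]]; exists f.
apply: (@spikeI _ _ _ _ _ (B i u) (B f u)) => //.
- by apply: (nz_sign BSP); move: ui; rewrite inE.
- exact: (nz_sign BSP).
move=> w; rewrite -Sfu (bigD1 i) //= big1 ?addr0 // => j /andP[jb ji].
apply/eqP; rewrite mulf_eq0; apply/orP; right; apply: contraNT ji => Bju.
by apply/eqP; apply: (disjoint_big_eq jb ib _ ui); rewrite inE.
Qed.

(** Leaves are spikes of column [i], so there are at most 3 and the excess is at most [6 - 4 = 2];
    tightness forces equality in both estimates. *)
Lemma disjoint_leaves i : i \in big B -> #|leaves B (supp B i)| = 3 /\ #|supp B i| = 4.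
Proof.
have le3 j : j \in big B -> (#|leaves B (supp B j)| <= 3)%N.
  move=> jb; apply: spikes_card_le3 (half_inv_hf BSP) _ => p.
  exact: disjoint_leaf_spike.
have bound j : j \in big B -> \sum_(u in supp B j) (2 - (deg B u)%:Z) <= 2 * #|leaves B (supp B j)|%:Z - #|supp B j|%:Z.
  by move=> jb; apply: odd_cell_bound => u; apply: disjoint_deg_odd.
move=> ib; have := tight_cells (cell := fun i u => u \in supp B i) (sum_deg B).
have le2 j : j \in big B -> \sum_(u in supp B j) (2 - (deg B u)%:Z) <= 2.
  move=> jb; apply: le_trans (bound j jb) _.
  by have := le3 j jb; have := supp_even BSP j; have := big_supp_ge4 BSP jb; lia.
move/(_ _ _ le2 i ib) => sum2.
have : 2 <= 2 * #|leaves B (supp B i)|%:Z - #|supp B i|%:Z.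
  rewrite -{1}sum2; first exact: bound.
    by move=> u nou; apply: (deg_no_big BSP) => j jb; apply/eqP; have := nou j jb; rewrite inE negbK.
  by move=> j k u; apply: disjoint_big_eq.
by have := le3 i ib; have := big_supp_ge4 BSP ib; lia.
Qed.

(** Two big rows would supply disjoint spike sets of size 3. *)
Lemma disjoint_big_unique i j : i \in big B -> j \in big B -> i = j.
Proof.
move=> ib jb; apply/eqP; apply: contraT => ij; exfalso.
have [[Li _] [Lj _]] := (disjoint_leaves ib, disjoint_leaves jb).
apply: (@spikes_disjoint _ S (S^~ i) (S^~ j) (leaves B (supp B i)) (leaves B (supp B j))).
- exact: half_inv_hf BSP.
- by move=> w; apply: S1.
- by move=> w; apply: S1.
- by move=> p; apply: disjoint_leaf_spike.
- by move=> p; apply: disjoint_leaf_spike.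
- by rewrite Li.
- by rewrite Lj.
apply: disjointWl (disjointWr _ (disjB ib jb ij)); by apply/subsetP => u; rewrite inE => /andP[].
Qed.

Lemma tu_hole_disjoint : (0 < n)%N -> tu_hole B /\ tu_hole B^T.
Proof.
move=> n_gt0; have [/eqP nobig|[r rb]] := set_0Vmem (big B).
  by apply: tu_hole_graph BSP n_gt0 _; apply/eqP.
have [L3 s4] := disjoint_leaves rb.
have /cards1P[c cE] : #|supp B r :\: leaves B (supp B r)| == 1%N.
  rewrite cardsD s4 (setIidPr _) ?L3 //; by apply/subsetP => u; rewrite inE => /andP[].
have : c \in supp B r :\: leaves B (supp B r) by rewrite cE set11.
rewrite in_setD => /andP[cL cr].
apply: (@tu_hole_tripod _ B S BSP r c (leaves B (supp B r))) => //.
- by apply/setP => i; rewrite in_set1; apply/idP/eqP => [ib|->//]; apply: disjoint_big_unique.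
- rewrite -[LHS](setID _ (leaves B (supp B r))) cE setUC; congr (_ :|: _).
  by apply/setIidPr/subsetP => u; rewrite inE => /andP[].
by move=> u; rewrite inE => /andP[_ /eqP].
Qed.

End DisjointRows.

(** * Laminar big rows *)

Section LaminarRows.

Variables (n : nat) (B S : 'M[int]_n).
Hypothesis BSP : half_inverse_pair B S.
Hypothesis Bnn : forall i j, B i j = 0 \/ B i j = 1.
Hypothesis lamB : forall i j, i \in big B -> j \in big B ->
  [\/ [disjoint supp B i & supp B j], supp B i \subset supp B j
    | supp B j \subset supp B i].

Let S1 := half_inv_sign BSP.

Definition above i := [set j in big B | supp B i \subset supp B j].
(** For a column in the cell of [i] the big rows through it are those of [above i], so this sum is
    the big-row part of [S B = 2] there. *)
Definition above_sum i w := \sum_(j in above i) S w j.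
Definition cell i :=
  [set u in supp B i | [forall (j | j \in big B), (u \in supp B j) ==> (supp B i \subset supp B j)]].
(** [s] is a child of [i] in the forest of big rows. *)
Definition cover s i := [&& s \in big B, supp B s \proper supp B i &
  [forall (j | j \in big B), (supp B s \subset supp B j) && (supp B j \proper supp B i) ==> (j == s)]].

Lemma supp_inj : injective (supp B).
Proof.
move=> i j eq_ij; have eqB u : B i u = B j u.
  have : (u \in supp B i) = (u \in supp B j) by rewrite eq_ij.
  by rewrite !inE; case: (Bnn i u) (Bnn j u) => -> [] ->.
have := half_inv_row BSP i i; under eq_bigr => u _ do rewrite eqB.
by rewrite (half_inv_row BSP) eqxx; have [->|] := eqVneq j i.
Qed.

Lemma lam_meet i j u : i \in big B -> j \in big B -> u \in supp B i -> u \in supp B j ->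
  supp B i \subset supp B j \/ supp B j \subset supp B i.
Proof.
move=> ib jb ui uj; case: (lamB ib jb) => [dij||]; [|by left|by right].
by have := disjointFr dij ui; rewrite uj.
Qed.

Lemma cellP i u : reflect
  (u \in supp B i /\ forall j, j \in big B -> u \in supp B j -> supp B i \subset supp B j)
  (u \in cell i).
Proof.
rewrite [u \in cell i]in_set; apply: (iffP andP) => -[ui minu]; split=> //.
  by move=> j jb; apply/implyP; move/forall_inP: minu; apply.
by apply/forall_inP => j jb; apply/implyP; apply: minu.
Qed.

Lemma cell_uniq i j u : i \in big B -> j \in big B -> u \in cell i -> u \in cell j -> i = j.
Proof.
move=> ib jb /cellP[ui mini] /cellP[uj minj]; apply/supp_inj/eqP.
by rewrite eqEsubset mini ?minj.
Qed.

Lemma exists_cell i u : i \in big B -> u \in supp B i ->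
  exists j, [/\ j \in big B, u \in cell j & supp B j \subset supp B i].
Proof.
move=> ib ui.
have [|j /andP[jb uj] minj] :=
    @arg_minnP _ i [pred j | (j \in big B) && (u \in supp B j)] (fun j => #|supp B j|).
  by rewrite /= ib.
have min_sub k : k \in big B -> u \in supp B k -> supp B j \subset supp B k.
  move=> kb uk; have [//|kj] := lam_meet jb kb uj uk.
  have := minj k; rewrite /= kb uk => /(_ isT) le_jk.
  by have /eqP-> : supp B k == supp B j by rewrite eqEcard kj le_jk.
by exists j; split=> //; [apply/cellP | apply: min_sub].
Qed.

Lemma above_cell i u j : i \in big B -> u \in cell i -> (j \in above i) = (j \in big B) && (u \in supp B j).
Proof.
move=> ib /cellP[ui minu]; rewrite [j \in above i]in_set; have [jb /=|//] := boolP (j \in big B).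
by apply/idP/idP => [/subsetP/(_ u ui)//|]; apply: minu.
Qed.

Lemma sum_big_cell i u w : i \in big B -> u \in cell i ->
  \sum_(j in big B) S w j * B j u = above_sum i w.
Proof.
move=> ib ui; rewrite /above_sum [LHS]big_mkcond [RHS]big_mkcond.
apply: eq_bigr => j _; rewrite (above_cell _ ib ui) [u \in supp B j]in_set.
by case: (j \in big B) => //=; case: (Bnn j u) => ->; rewrite ?mulr1 ?mulr0.
Qed.

Lemma dep_cell i u : i \in big B -> u \in cell i -> dep B u = #|above i|.
Proof.
move=> ib ui; apply: eq_card => j.
by rewrite (above_cell _ ib ui) [LHS]in_set [u \in supp B j]in_set.
Qed.

Lemma odd_deg_cell i u : i \in big B -> u \in cell i -> odd (deg B u) = odd #|above i|.
Proof.
move=> ib ui; have := deg_dep_even BSP u; rewrite (dep_cell ib ui) oddD.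
by case: odd; case: odd.
Qed.

(** The even set [supp B i] is partitioned into the cells of the big rows inside it, and by
    induction on size the other cells are even. *)
Lemma cell_even i : i \in big B -> ~~ odd #|cell i|.
Proof.
have [m] := ubnP #|supp B i|; elim: m i => // m IHm i lt_im ib.
have suppE : #|supp B i| = (\sum_(j in big B | supp B j \subset supp B i) #|cell j|)%N.
  rewrite -sum1_card; under [RHS]eq_bigr => j _ do rewrite -sum1_card.
  rewrite (exchange_big_dep (mem (supp B i))) /=; last first.
    by move=> j u /andP[_ /subsetP ji] /cellP[/ji].
  apply: eq_bigr => u ui; have [j [jb uj ji]] := exists_cell ib ui.
  rewrite (big_pred1 j) // => k /=.
  apply/andP/eqP => [[/andP[kb _] uk]|->]; first exact: cell_uniq uk uj.
  by rewrite jb ji.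
have := supp_even BSP i; rewrite suppE (bigD1 i) /=; last by rewrite ib subxx.
rewrite oddD; set rest := (\sum_(j | _) _)%N; suff -> : odd rest = false by rewrite addbF.
rewrite /rest; elim/big_rec: _ => // j s /andP[/andP[jb ji] j_i] s_even.
rewrite oddD s_even addbF; apply/negbTE/IHm => //.
apply: leq_trans (_ : #|supp B j| < #|supp B i|)%N _; last by rewrite -ltnS.
apply: proper_card; rewrite properEneq ji andbT.
by apply: contraNneq j_i => /supp_inj->.
Qed.

(** The leaf relation for 0/1 entries, before [s] is known to be a sign vector. *)
Definition wspike (s : 'I_n -> int) p := exists q, forall w, s w + S w q = 2 * (w == p)%:R.

(** Away from its tip [p] a spike shows that [s] is minus a column of [S]; every [w] avoids one of
    two distinct tips. *)
Lemma wspikes_sign s (X : {set 'I_n}) : (1 < #|X|)%N -> (forall p, p \in X -> wspike s p) ->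
  forall w, s w = 1 \/ s w = -1.
Proof.
move=> /card_gt1P[x [y [xX yX xy]]] spX w.
have [p pX wp] : exists2 p, p \in X & w != p.
  by have [->|wx] := eqVneq w x; [exists y | exists x].
have [q /(_ w)] := spX p pX; rewrite (negPf wp) mulr0.
by case: (S1 w q) => ->; lia.
Qed.

Lemma wspikes_spike s (X : {set 'I_n}) : (1 < #|X|)%N -> (forall p, p \in X -> wspike s p) ->
  forall p, p \in X -> exists q, spike S s p q.
Proof.
move=> X1 spX p pX; have [q sq] := spX p pX; exists q.
apply: (@spikeI _ _ _ _ _ 1 1) => //; [by left | by left | exact: (wspikes_sign X1 spX) |].
by move=> w; rewrite !mulr1.
Qed.

Lemma wspikes_card s (X : {set 'I_n}) : (forall p, p \in X -> wspike s p) -> (#|X| <= 3)%N.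
Proof.
move=> spX; have [|X1] := leqP #|X| 1; first by move/leq_trans->.
by apply: spikes_card_le3 (half_inv_hf BSP) (wspikes_spike X1 spX).
Qed.

Lemma leaf_wspike i u : i \in big B -> u \in leaves B (cell i) -> wspike (above_sum i) u.
Proof.
move=> ib; rewrite [u \in leaves _ _]in_set => /andP[ui /eqP/(deg1P BSP)[f _ [Bfu Sfu]]]; exists f => w.
rewrite -Sfu (sum_big_cell _ ib ui); have -> : B f u = 1 by case: (Bnn f u) Bfu => ->.
by rewrite mulr1.
Qed.

Lemma deg0_wsum i u w : i \in big B -> u \in cell i -> deg B u = 0%N ->
  above_sum i w = 2 * (w == u)%:R.
Proof. by move=> ib ui degu; rewrite -(deg0P BSP degu) (sum_big_cell _ ib ui). Qed.

(** All degrees in the cell are even: an isolated column contributes 2, any other at most 0. *)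
Lemma even_cell_bound i : i \in big B -> ~~ odd #|above i| ->
  \sum_(u in cell i) (2 - (deg B u)%:Z) <= 2 * #|[set u in cell i | deg B u == 0%N]|%:Z.
Proof.
move=> ib ev.
have -> : 2 * #|[set u in cell i | deg B u == 0%N]|%:Z =
          \sum_(u in cell i) (2 * (deg B u == 0%N)%:R).
  rewrite -mulr_sumr; congr (2 * _).
  rewrite -sum1_card (big_morph _ PoszD erefl) big_mkcond [RHS]big_mkcond.
  by apply: eq_bigr => u _; rewrite [u \in [set _ in cell i | _]]in_set; case: (u \in cell i); case: (_ == _).
apply: ler_sum => u ui; have := odd_deg_cell ib ui; rewrite (negPf ev).
by case: eqP => [->//|]; lia.
Qed.

(** At odd depth there are at most 3 leaves, and with 3 of them the even cell has at least 4
    elements. At even depth an isolated column [u] makes [above_sum i] twice the unit vector at [u],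
    so there is at most one. *)
Lemma cell_bound i : i \in big B -> \sum_(u in cell i) (2 - (deg B u)%:Z) <= 2.
Proof.
move=> ib; have [od|ev] := boolP (odd #|above i|).
  have le3 : (#|leaves B (cell i)| <= 3)%N.
    by apply: (@wspikes_card (above_sum i)) => p; apply: leaf_wspike.
  have oddc u : u \in cell i -> odd (deg B u) by move=> ui; rewrite (odd_deg_cell ib ui).
  apply: le_trans (odd_cell_bound oddc) _.
  have : (#|leaves B (cell i)| <= #|cell i|)%N.
    by apply/subset_leq_card/subsetP => u; rewrite inE => /andP[].
  by have := cell_even ib; lia.
apply: le_trans (even_cell_bound ib ev) _.
suff : (#|[set u in cell i | deg B u == 0%N]| <= 1)%N by lia.
apply/card_le1_eqP => u v; rewrite ![_ \in [set _ in cell i | _]]in_set => /andP[ui /eqP u0] /andP[vi /eqP v0].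
have := deg0_wsum u ib ui u0; rewrite (deg0_wsum u ib vi v0) eqxx.
by case: eqP.
Qed.

Lemma cell_tight i : i \in big B -> \sum_(u in cell i) (2 - (deg B u)%:Z) = 2.
Proof.
apply: (tight_cells (cell := fun i u => u \in cell i) (sum_deg B)).
- move=> u nou; apply: (deg_no_big BSP) => j jb; apply/eqP; apply: contraT => Bju.
  have [|k [kb uk _]] := @exists_cell j u jb; first by rewrite inE.
  by have := nou k kb; rewrite uk.
- exact: cell_uniq.
exact: cell_bound.
Qed.

Lemma odd_cell_shape i : i \in big B -> odd #|above i| ->
  #|leaves B (cell i)| = 2%N /\ #|cell i| = 2%N \/ #|leaves B (cell i)| = 3%N.
Proof.
move=> ib od.
have le3 : (#|leaves B (cell i)| <= 3)%N.
  by apply: (@wspikes_card (above_sum i)) => p; apply: leaf_wspike.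
have oddc u : u \in cell i -> odd (deg B u) by move=> ui; rewrite (odd_deg_cell ib ui).
have := odd_cell_bound oddc; rewrite (cell_tight ib).
have : (#|leaves B (cell i)| <= #|cell i|)%N.
  by apply/subset_leq_card/subsetP => u; rewrite inE => /andP[].
by have := cell_even ib; lia.
Qed.

Lemma even_cell_deg0 i : i \in big B -> ~~ odd #|above i| ->
  exists2 v, v \in cell i & deg B v = 0%N.
Proof.
move=> ib ev; have := even_cell_bound ib ev; rewrite (cell_tight ib) => le2.
have /card_gt0P[v] : (0 < #|[set u in cell i | deg B u == 0%N]|)%N by lia.
by rewrite [v \in _]in_set => /andP[vi /eqP v0]; exists v.
Qed.

(** * The forest of big rows and its pseudo-leaves *)

Lemma coverP s i : reflect
  [/\ s \in big B, supp B s \proper supp B i & forall j, j \in big B ->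
    supp B s \subset supp B j -> supp B j \proper supp B i -> j = s]
  (cover s i).
Proof.
apply: (iffP and3P) => -[sb si cov]; split=> //.
  by move=> j jb sj ji; apply/eqP; move/forall_inP/(_ j jb): cov; rewrite sj ji.
by apply/forall_inP => j jb; apply/implyP => /andP[sj ji]; apply/eqP/cov.
Qed.

Lemma exists_cover i j : j \in big B -> supp B j \proper supp B i ->
  exists2 s, cover s i & supp B j \subset supp B s.
Proof.
move=> jb ji.
have [|s /and3P[sb js si] maxs] := @arg_maxnP _ j
  [pred k | [&& k \in big B, supp B j \subset supp B k & supp B k \proper supp B i]]
  (fun k => #|supp B k|).
  by rewrite /= jb subxx.
exists s => //; apply/coverP; split=> // k kb sk ki; apply/supp_inj/eqP.
rewrite eq_sym eqEcard sk; apply: maxs.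
by rewrite /= kb ki (subset_trans js sk).
Qed.

Lemma in_above i j : (j \in above i) = (j \in big B) && (supp B i \subset supp B j).
Proof. by rewrite [LHS]in_set. Qed.

Lemma above_cover s i : i \in big B -> cover s i ->
  above s = s |: above i /\ s \notin above i.
Proof.
move=> ib /coverP[sb si cov]; split; last first.
  by rewrite in_above sb /= proper_subn.
apply/setP => j; rewrite in_setU1 !in_above.
apply/andP/orP => [[jb sj]|[/eqP->|/andP[jb ij]]]; last 2 first.
- by rewrite sb subxx.
- by rewrite jb (subset_trans (proper_sub si) ij).
have /card_gt0P[u us] := supp_neq0 BSP s.
have [ij|ji] := lam_meet ib jb (subsetP (proper_sub si) u us) (subsetP sj u us).
  by right; rewrite jb.
have [/supp_inj->|ij] := eqVneq (supp B j) (supp B i); first by right; rewrite ib subxx.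
by left; apply/eqP/cov; rewrite // properEneq ij.
Qed.

Lemma card_above_cover s i : i \in big B -> cover s i -> #|above s| = #|above i|.+1.
Proof. by move=> ib /(above_cover ib)[-> si]; rewrite cardsU1 si. Qed.

Lemma cover_fun s i i' : i \in big B -> i' \in big B -> cover s i -> cover s i' -> i = i'.
Proof.
move=> ib ib' cov cov'.
have sub j j' : j \in big B -> j' \in big B -> cover s j -> cover s j' -> supp B j' \subset supp B j.
  move=> jb jb' /(above_cover jb)[aj sj] /(above_cover jb')[aj' _].
  have : j \in above s by rewrite aj in_setU1 in_above jb subxx orbT.
  rewrite aj' in_setU1 in_above => /orP[/eqP js|/andP[_ ->]//].
  by move: sj; rewrite -js in_above jb subxx.
by apply/supp_inj/eqP; rewrite eqEsubset !sub.
Qed.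

(* If [s] covers [i], an isolated column of the cell of [s] makes column [s] of
   [S] a spike for [above_sum i], just as the edge at a leaf of the cell of [i]. *)
Definition pseudo_leaves i :=
  leaves B (cell i) :|: [set v | (deg B v == 0%N) && [exists s, cover s i && (v \in cell s)]].

Lemma pseudo_leafP i u : reflect
  (u \in leaves B (cell i) \/ deg B u = 0%N /\ exists2 s, cover s i & u \in cell s)
  (u \in pseudo_leaves i).
Proof.
rewrite in_setU [X in _ || X]in_set; apply: (iffP orP) => -[|]; try by left.
  by move=> /andP[/eqP d0 /existsP[s /andP[cov us]]]; right; split=> //; exists s.
by move=> [d0 [s cov us]]; right; rewrite d0; apply/existsP; exists s; rewrite cov.
Qed.

Lemma pseudo_leaf_wspike i u : i \in big B -> u \in pseudo_leaves i -> wspike (above_sum i) u.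
Proof.
move=> ib /pseudo_leafP[|[d0 [s cov us]]]; first exact: leaf_wspike.
have [sb _ _] := coverP _ _ cov; have [as_ si] := above_cover ib cov.
exists s => w; rewrite -(deg0_wsum w sb us d0) /above_sum as_ big_setU1 //=.
by rewrite addrC.
Qed.

(** A child has even depth, so tightness puts an isolated column into its cell. *)
Lemma cover_pseudo_leaf s i : i \in big B -> odd #|above i| -> cover s i ->
  exists2 v, v \in cell s & v \in pseudo_leaves i /\ deg B v = 0%N.
Proof.
move=> ib od cov; have [sb _ _] := coverP _ _ cov.
have [|v vs d0] := even_cell_deg0 sb; first by rewrite (card_above_cover ib cov) /= od.
by exists v => //; split=> //; apply/pseudo_leafP; right; split=> //; exists s.
Qed.

Lemma leaf_deg i u : u \in leaves B (cell i) -> u \in cell i /\ deg B u = 1%N.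
Proof. by rewrite [u \in leaves _ _]in_set => /andP[-> /eqP]. Qed.

Lemma exists_cover_odd i : i \in big B -> #|cell i| = 2%N -> exists s, cover s i.
Proof.
move=> ib c2.
have : ~~ (supp B i \subset cell i).
  by apply/negP => /subset_leq_card; rewrite c2; have := big_supp_ge4 BSP ib; lia.
case/subsetPn => u ui uNi; have [j [jb uj ji]] := exists_cell ib ui.
have [|s cov _] := @exists_cover i j jb; last by exists s.
by rewrite properEneq ji andbT; apply: contraNneq uNi => /supp_inj <-.
Qed.

(** If the cell consists of two leaves only, it does not exhaust the big row, so there is a child,
    whose isolated column is the third pseudo-leaf. *)
Lemma card_pseudo_leaves i : i \in big B -> odd #|above i| -> (2 < #|pseudo_leaves i|)%N.
Proof.
move=> ib od; have [[l2 c2]|l3] := odd_cell_shape ib od; last first.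
  by rewrite -l3; apply/subset_leq_card/subsetP => u uL; rewrite in_setU uL.
have [s cov] := exists_cover_odd ib c2.
have [v vs [vP d0]] := cover_pseudo_leaf ib od cov.
have vL : v \notin leaves B (cell i) by apply/negP => /leaf_deg[_]; rewrite d0.
have <- : #|v |: leaves B (cell i)| = 3%N by rewrite cardsU1 vL l2.
apply/subset_leq_card/subsetP => u; rewrite in_setU1 => /orP[/eqP->//|uL].
by rewrite in_setU uL.
Qed.

(** Distinct rows of odd depth have disjoint sets of pseudo-leaves: leaves determine their cell, and
    isolated columns determine a child and hence its parent. *)
Lemma odd_big_unique i j : i \in big B -> j \in big B ->
  odd #|above i| -> odd #|above j| -> i = j.
Proof.
move=> ib jb iod jod; apply/eqP; apply: contraT => /eqP ij; exfalso.
have [ci cj] := (card_pseudo_leaves ib iod, card_pseudo_leaves jb jod).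
have spi p : p \in pseudo_leaves i -> wspike (above_sum i) p by apply: pseudo_leaf_wspike.
have spj p : p \in pseudo_leaves j -> wspike (above_sum j) p by apply: pseudo_leaf_wspike.
apply: (@spikes_disjoint _ S (above_sum i) (above_sum j) (pseudo_leaves i) (pseudo_leaves j)) => //.
- exact: half_inv_hf BSP.
- exact: wspikes_sign (ltnW ci) spi.
- exact: wspikes_sign (ltnW cj) spj.
- exact: wspikes_spike (ltnW ci) spi.
- exact: wspikes_spike (ltnW cj) spj.
rewrite -setI_eq0; apply/eqP/setP => u; rewrite in_setI in_set0; apply/negP => /andP[].
move=> /pseudo_leafP[/leaf_deg[ui d1]|[d0 [s covs us]]] /pseudo_leafP[/leaf_deg[uj d1']|[d0' [t covt ut]]].
- exact: ij (cell_uniq ib jb ui uj).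
- by rewrite d1 in d0'.
- by rewrite d1' in d0.
have [[sb _ _] [tb _ _]] := (coverP _ _ covs, coverP _ _ covt).
have st := cell_uniq sb tb us ut; rewrite -st in covt.
exact: ij (cover_fun ib jb covs covt).
Qed.

Lemma exists_odd_above j : j \in big B ->
  exists r, [/\ r \in big B, odd #|above r| & supp B j \subset supp B r].
Proof.
move=> jb; have [|r] := @arg_maxnP _ j (mem (above j)) (fun k => #|supp B k|).
  by rewrite /= in_above jb subxx.
rewrite /= in_above => /andP[rb jr] maxr; exists r; split=> //.
(* A maximal big row has depth 1. *)
suff -> : above r = [set r] by rewrite cards1.
apply/setP => k; rewrite in_set1 in_above; apply/andP/eqP => [[kb rk]|->]; last by rewrite rb.
apply/supp_inj/eqP; rewrite eq_sym eqEcard rk; apply: maxr.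
by rewrite /= in_above kb (subset_trans jr rk).
Qed.

(** A grandchild of [r] would have odd depth again, against uniqueness. *)
Lemma big_covers r j : r \in big B -> odd #|above r| -> j \in big B -> j != r -> cover j r.
Proof.
move=> rb od jb jr.
have [k [kb kod jk]] := exists_odd_above jb.
rewrite (odd_big_unique kb rb kod od) in jk.
have jr_proper : supp B j \proper supp B r.
  by rewrite properEneq jk andbT; apply: contraNneq jr => /supp_inj->.
have [s cov js] := exists_cover jb jr_proper; have [sb sr _] := coverP _ _ cov.
have [->//|sj] := eqVneq j s.
have [|t covt _] := @exists_cover s j jb.
  by rewrite properEneq js andbT; apply: contraNneq sj => /supp_inj->.
have [tb ts _] := coverP _ _ covt.
have tr : t = r.
  apply: odd_big_unique => //; rewrite (card_above_cover sb covt) (card_above_cover rb cov).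
  by rewrite /= negbK.
by move: (proper_trans ts sr); rewrite tr properxx.
Qed.

(** A single big row is the disjoint case. Otherwise every other big row is a child of [r] and adds
    a pseudo-leaf; since [r] has at most 3, it has two leaves and exactly one child. *)
Lemma tu_hole_laminar : (0 < n)%N -> tu_hole B /\ tu_hole B^T.
Proof.
move=> n_gt0; have [nobig|[r0 r0b]] := set_0Vmem (big B).
  exact: tu_hole_graph BSP n_gt0 nobig.
have [r [rb od _]] := exists_odd_above r0b.
have le3 : (#|pseudo_leaves r| <= 3)%N.
  by apply: (@wspikes_card (above_sum r)) => p; apply: pseudo_leaf_wspike.
have [s /andP[sb sr]|only_r] := pickP (fun s => (s \in big B) && (s != r)); last first.
  apply: (tu_hole_disjoint BSP) => // i j ib jb; have := only_r i; have := only_r j.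
  by rewrite ib jb /= => /negbFE/eqP-> /negbFE/eqP->; rewrite eqxx.
have covs := big_covers rb od sb sr; have [_ sr_proper _] := coverP _ _ covs.
have [v vs [vP d0]] := cover_pseudo_leaf rb od covs.
have vL : v \notin leaves B (cell r) by apply/negP => /leaf_deg[_]; rewrite d0.
have LP : leaves B (cell r) \subset pseudo_leaves r by apply/subsetP => u uL; rewrite in_setU uL.
have [[l2 c2]|l3] := odd_cell_shape rb od; last first.
  have : (#|v |: leaves B (cell r)| <= #|pseudo_leaves r|)%N.
    by apply/subset_leq_card; rewrite subUset sub1set vP.
  by rewrite cardsU1 vL l3 => /leq_trans/(_ le3).
have bigE : big B = [set r; s].
  apply/setP => j; rewrite in_set2; apply/idP/orP => [jb|[/eqP->|/eqP->//]]; last by [].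
  have [->|jr] := eqVneq j r; first by left.
  right; apply: contraT => js; exfalso.
  have covj := big_covers rb od jb jr.
  have [w wj [wP w0]] := cover_pseudo_leaf rb od covj.
  have wv : w != v by apply: contraNneq js => wv; rewrite (cell_uniq jb sb wj (u := w)) ?wv.
  have : (#|w |: (v |: leaves B (cell r))| <= #|pseudo_leaves r|)%N.
    by apply/subset_leq_card; rewrite !subUset !sub1set vP wP.
  have wL : w \notin leaves B (cell r) by apply/negP => /leaf_deg[_]; rewrite w0.
  by rewrite !cardsU1 in_setU1 negb_or wv wL vL l2 => /leq_trans/(_ le3).
have LC : leaves B (cell r) = cell r.
  by apply/eqP; rewrite eqEcard l2 c2 andbT; apply/subsetP => u /leaf_deg[].
move: (l2) => /eqP/cards2P[x [x' [xx' LE]]].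
have cell_not_s u : u \in cell r -> u \notin supp B s.
  move=> /cellP[_ /(_ s sb) minu]; apply/negP => /minu rs.
  by have := proper_subn sr_proper; rewrite rs.
have xL : x \in leaves B (cell r) by rewrite LE set21.
have x'L : x' \in leaves B (cell r) by rewrite LE set22.
apply: (@tu_hole_nested _ B S r s v x x') => //.
- by rewrite eq_sym.
- by apply: cell_not_s; rewrite -LC.
- by apply: cell_not_s; rewrite -LC.
- rewrite -LE LC; apply/setP => u; rewrite in_setU; apply/idP/orP => [ur|[|us]].
  + have [j [jb uj _]] := exists_cell rb ur.
    move: jb; rewrite bigE in_set2 => /orP[/eqP jr|/eqP js]; subst j; first by left.
    by right; case/cellP: uj.
  + by case/cellP.
  by apply: (subsetP (proper_sub sr_proper)).
- by case/cellP: vs.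
by have [_] := leaf_deg xL.
Qed.

End LaminarRows.

(** * The theorem *)

Lemma mixed_incidence_sgn01 m n (D : mixed_hypergraph m n) v a :
  mixed_incidence D v a \in sgn01.
Proof. by rewrite mxE; case: ifP => // _; case: ifP. Qed.

Lemma supp_mixed_incidence n (D : mixed_hypergraph n n) a :
  supp (mixed_incidence D)^T a = arc_support D a.
Proof.
by apply/setP => v; rewrite !inE !mxE; case: ifP => // _; case: ifP.
Qed.

Lemma supp_hypergraph_incidence n (G : hypergraph n n) e :
  supp (hypergraph_incidence G)^T e = hyperedge G e.
Proof. by apply/setP => v; rewrite inE !mxE; case: ifP. Qed.

Lemma exists_half_inverse_pair n (B : 'M[int]_n) :
  almost_totally_unimodular B -> (forall i j, B i j \in sgn01) ->
  (0 < n)%N /\ exists S, half_inverse_pair B S.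
Proof.
move=> atuB B01; have detB := almost_totally_unimodular_det atuB.
(* In orders 0 and 1 the determinant would be 0, 1 or -1. *)
have n_gt1 : (1 < n)%N.
  case: n B {atuB} B01 detB => [|[|//]] B B01; first by rewrite det_mx00.
  by rewrite det_mx11 B01.
split; first exact: ltnW.
have [S [BS SB S1]] := exists_half_inverse n_gt1 atuB.
exists S; split=> //; exact: half_inverse_hadamard_free atuB BS SB S1.
Qed.

(** The preceding results apply to [B = M^T], whose rows are the hyperedges; treating [B] and its
    transpose together covers both orientations in the theorem. *)
Lemma tu_hole_incidence n (M : 'M[int]_n) :
  almost_totally_unimodular M -> disjoint_mixed_or_laminar_incidence M ->
  tu_hole M^T /\ tu_hole M.
Proof.
move=> /almost_totally_unimodular_tr atuB [[D [disjD defM]]|[G [lamG defM]]]; subst M.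
  have [|n_gt0 [S BSP]] := exists_half_inverse_pair atuB.
    by move=> i j; rewrite mxE mixed_incidence_sgn01.
  rewrite -[mixed_incidence D in X in _ /\ X]trmxK.
  apply: (tu_hole_disjoint BSP) => // i j /(big_supp_ge4 BSP) i4 /(big_supp_ge4 BSP) j4 ij.
  by move: i4 j4; rewrite !supp_mixed_incidence; apply: disjD.
have Bnn i j : (hypergraph_incidence G)^T i j = 0 \/ (hypergraph_incidence G)^T i j = 1.
  by rewrite !mxE; case: ifP; [right | left].
have [|n_gt0 [S BSP]] := exists_half_inverse_pair atuB.
  by move=> i j; case: (Bnn i j) => ->.
rewrite -[hypergraph_incidence G in X in _ /\ X]trmxK.
apply: (tu_hole_laminar BSP) => // i j /(big_supp_ge4 BSP) i4 /(big_supp_ge4 BSP) j4.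
by move: i4 j4; rewrite !supp_hypergraph_incidence; apply: lamG.
Qed.

Theorem corollary1p13 (m n : nat) (A : 'M[int]_(m, n))
    (A_almost : almost_totally_unimodular A)
    (A_incidence : disjoint_mixed_or_laminar_incidence A \/
                   disjoint_mixed_or_laminar_incidence A^T) :
  exists (p : nat) (L : 'M[int]_(p, m)),
    totally_unimodular L /\ unbalanced_hole (L *m A).
Proof.
have eq_mn := almost_totally_unimodular_square A_almost; subst n.
case: A_incidence => [/(tu_hole_incidence A_almost)[] //|inc].
have := tu_hole_incidence (almost_totally_unimodular_tr A_almost) inc.
by rewrite trmxK => -[].
Qed.
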